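(* Let $d$ be odd and let $C\subset A$ be a curve obtained by the construction described in the context, from an abelian surface $A$ with polarizing line bundle $L$ of type $(1,d)$ and a subgroup $X\le K(L)$ of order $d$. Then for every $x\in X$ the involution $[-1]\circ t_x$ of $C$ has exactly $6$ fixed points on $C$.
   Context: Everything is over $\mathbb{C}$. On an abelian variety, $t_x$ is translation by $x$ and $[-1]$ is the inverse map, so $[-1]\circ t_x$ is the map $a\mapsto -a-x$. Construction of $C$. Let $d\ge 1$ and let $A=V/\Lambda$ be an abelian surface with a polarization of type $(1,d)$, with alternating form $E:V\times V\to\mathbb{R}$ (integer valued on $\Lambda$). For an ample line bundle $L$ in this class, put $\varphi_L:A\to A^\vee$, $a\mapsto t_a^*L\otimes L^{-1}$, and $K(L)=\ker\varphi_L\cong(\mathbb{Z}/d\mathbb{Z})^2$ (depending only on the class). Let $X\le K(L)$ be a subgroup of order $d$ and $\pi:A\to A/X=V/\Lambda'$ the quotient isogeny, $\Lambda\subseteq\Lambda'$. Then $E$ also defines a principal polarization on $A/X$. Choose a real decomposition $V=V_1\oplus V_2$ into $E$-isotropic subspaces with $\Lambda=(\Lambda\cap V_1)\oplus(\Lambda\cap V_2)$ and $\Lambda'=(\Lambda'\cap V_1)\oplus(\Lambda'\cap V_2)$ (such a choice exists). Let $L$ on $A$ and $M$ on $A/X$ be the line bundles of characteristic $0$ for this decomposition, i.e. those with first Chern class $E$ and semicharacter $\chi_0(v_1+v_2)=\exp(\pi i E(v_1,v_2))$ for $v_i\in V_i$; they are symmetric and $\pi^*M\cong L$. Assume $(A/X,M)$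 is the Jacobian of a smooth genus $2$ curve, i.e. the unique effective divisor $H\in|M|$ is a smooth curve of genus $2$. Set $C:=\pi^{-1}(H)\in|L|$. Then $C$ is a smooth curve, $\pi|_C:C\to H$ is an unramified covering with group $X$, and the maps $t_x$ and $[-1]\circ t_x$ for $x\in X$ restrict to automorphisms of $C$. *)

(* Defs.v *)
From HB Require Import structures.
From mathcomp Require Import all_boot all_order all_algebra.
From mathcomp Require Import generic_quotient ring_quotient.
From mathcomp Require Import all_classical all_reals all_analysis.
From mathcomp Require Import complex.

Set Implicit Arguments.
Unset Strict Implicit.
Unset Printing Implicit Defensive.

Import Order.TTheory GRing.Theory Num.Theory.
Import numFieldNormedType.Exports.

Local Open Scope classical_set_scope.
Local Open Scope ring_scope.
Local Open Scope quotient_scope.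
Local Open Scope complex_scope.

(* Topology and norm of [R[i]], transported from its regular module. *)
HB.instance Definition _ (R : realType) :=
  NormedModule.copy R[i] (R[i] : numFieldType)^o.

Section ComplexTorus.
Variable R : realType.
Local Notation C := R[i].
Local Notation V := 'rV[R[i]]_2.

Definition cexp (z : C) : C :=
  (expR (complex.Re z))%:C * (cos (complex.Im z) +i* sin (complex.Im z)).

Definition holomorphic (f : V -> C) : Prop := forall v : V, differentiable f v.

(* For a subgroup L of V = C^2, [{ideal_quot L}] is the quotient group V/L:
   the construction in ring_quotient only needs L to be closed under
   subtraction, despite the notation. *)

Definition real_basis n (b : 'I_n -> V) : Prop :=
  forall v : V, exists! c : 'rV[R]_n, v = \sum_i (c ord0 i)%:C *: b i.

Definition lattice_basis (L : zmodClosed V) n (b : 'I_n -> V) : Prop :=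
  real_basis b /\
  forall v : V, v \in L <-> exists c : 'I_n -> int, v = \sum_i b i *~ c i.

(* E is the imaginary part of a positive definite Hermitian form, integral
   on L. *)
Record polarization (L : zmodClosed V) (E : V -> V -> R) : Prop := {
  pol_linl : forall (a : R) (u v w : V), E (a%:C *: u + v) w = a * E u w + E v w;
  pol_linr : forall (a : R) (u v w : V), E w (a%:C *: u + v) = a * E w u + E w v;
  pol_alt : forall v, E v v = 0;
  pol_int : forall u v, u \in L -> v \in L -> E u v \is a Num.int;
  pol_i : forall u v, E ('i *: u) ('i *: v) = E u v;
  pol_pos : forall v, v != 0 -> 0 < E ('i *: v) v }.

Definition polarization_type_1 (d : nat) (L : zmodClosed V) (E : V -> V -> R) :
    Prop :=
  polarization L E /\
  exists b : 'I_(2 + 2) -> V, lattice_basis L b /\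
    forall i j : 'I_2,
      [/\ E (b (lshift 2 i)) (b (lshift 2 j)) = 0,
          E (b (rshift 2 i)) (b (rshift 2 j)) = 0 &
          E (b (lshift 2 i)) (b (rshift 2 j)) =
            (if i == ord0 then 1 else d%:R) *+ (i == j)].

(* The Hermitian form with imaginary part E, C-linear in its first argument. *)
Definition hermitian (E : V -> V -> R) (v w : V) : C :=
  E ('i *: v) w +i* E v w.

(* A line bundle on V/L is given by a factor of automorphy e(l, v), for l in L
   and v in V, two factors giving isomorphic line bundles if and only if they
   differ by a coboundary; e acts on V x C by l.(v, t) = (v + l, e(l, v) t).
   Values of e at l outside L are irrelevant. *)
Definition factor := V -> V -> C.

Definition trivial_bundle (L : zmodClosed V) (e : factor) : Prop :=
  exists g : V -> C, [/\ holomorphic g, forall v, g v != 0 &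
    forall l v, l \in L -> e l v = g (v + l) / g v].

Definition translate_pullback (a : V) (e : factor) : factor :=
  fun l v => e l (v + a).

Definition tensor_inv (e f : factor) : factor := fun l v => e l v / f l v.

(* The kernel of a |-> t_a^* e (x) e^-1. *)
Definition K (L : zmodClosed V) (e : factor) : set {ideal_quot L} :=
  [set a | trivial_bundle L (tensor_inv (translate_pullback (repr a) e) e)].


(* The line bundle with first Chern class E and semicharacter chi. *)
Definition appell_humbert (E : V -> V -> R) (chi : V -> C) : factor :=
  fun l v => chi l * cexp (pi%:C * hermitian E v l
                           + (pi / 2)%:C * hermitian E l l).

Definition real_subspace (W : set V) : Prop :=
  W 0 /\ forall (a : R) u v, W u -> W v -> W (a%:C *: u + v).

Definition isotropic (E : V -> V -> R) (W : set V) : Prop :=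
  forall u v, W u -> W v -> E u v = 0.

Definition direct_sum (V1 V2 : set V) : Prop :=
  (forall v, exists v1 v2, [/\ V1 v1, V2 v2 & v = v1 + v2]) /\
  V1 `&` V2 = [set 0].

Definition lattice_split (L : zmodClosed V) (V1 V2 : set V) : Prop :=
  forall l, l \in L -> exists l1 l2,
    [/\ V1 l1 /\ l1 \in L, V2 l2 /\ l2 \in L & l = l1 + l2].

(* The V1-component of v along V2. *)
Definition component (V1 V2 : set V) (v : V) : V :=
  xget 0 [set u | V1 u /\ V2 (v - u)].

Definition chi0 (E : V -> V -> R) (V1 V2 : set V) (v : V) : C :=
  cexp ((pi * E (component V1 V2 v) (v - component V1 V2 v))%:C * 'i).

Definition char0_bundle (E : V -> V -> R) (V1 V2 : set V) : factor :=
  appell_humbert E (chi0 E V1 V2).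

(* Global sections of the line bundle given by e, as functions on V. *)
Definition is_section (L : zmodClosed V) (e : factor) (theta : V -> C) : Prop :=
  holomorphic theta /\
  forall l v, l \in L -> theta (v + l) = e l v * theta v.

Definition zero_divisor (L : zmodClosed V) (theta : V -> C) :
    set {ideal_quot L} :=
  [set p | theta (repr p) = 0].

Arguments zero_divisor : clear implicits.

(* The divisor of the section theta, with its scheme structure, is a smooth
   connected curve. *)
Definition smooth_curve (L : zmodClosed V) (theta : V -> C) : Prop :=
  (forall v, theta v = 0 -> exists w, 'd theta v w != 0) /\
  connected (zero_divisor L theta : set (quotient_topology {ideal_quot L})).

Definition tangent (theta : V -> C) (v : V) : set V :=
  [set w | 'd theta v w = 0].

(* Equality of two 1-forms along the curve theta = 0. *)
Definition eq_form (theta : V -> C) (eta eta' : V -> V -> C) : Prop :=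
  forall v w, theta v = 0 -> tangent theta v w -> eta v w = eta' v w.

(* Holomorphic 1-forms on the smooth curve (theta = 0) / L: L-invariant
   families of functionals on the tangent lines of theta = 0 that are locally
   restrictions of holomorphic 1-forms of V.  Values of eta v off the tangent
   line, or off theta = 0, are irrelevant. *)
Definition holomorphic_form (L : zmodClosed V) (theta : V -> C)
    (eta : V -> V -> C) : Prop :=
  (forall l, l \in L -> eq_form theta eta (fun v => eta (v + l))) /\
  forall v : V, theta v = 0 -> exists a1 a2 : V -> C,
    \forall u \near v, [/\ differentiable a1 u, differentiable a2 u &
      theta u = 0 -> forall w, tangent theta u w ->
        eta u w = a1 u * w ord0 ord0 + a2 u * w ord0 ord_max].

(* The geometric genus, i.e. dim H^0(Omega^1) = g. *)
Definition has_genus (g : nat) (L : zmodClosed V) (theta : V -> C) : Prop :=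
  exists eta : 'I_g -> V -> V -> C,
    (forall i, holomorphic_form L theta (eta i)) /\
    forall om, holomorphic_form L theta om ->
      exists! c : 'rV[C]_g,
        eq_form theta om (fun v w => \sum_i c ord0 i * eta i v w).

End ComplexTorus.

Arguments K {R} L e.
Arguments zero_divisor {R} L theta.

Section QuotientIsogeny.
Variables (R : realType) (L : zmodClosed 'rV[R[i]]_2).
Variable X : zmodClosed {ideal_quot L}.

(* The lattice L' with V/L' = (V/L)/X. *)
Definition overlattice : {pred 'rV[R[i]]_2} :=
  fun v => \pi_{ideal_quot L} v \in X.

Lemma overlattice_zmod_closed : zmod_closed overlattice.
Proof.
have piE v : (v \in overlattice) = (\pi_{ideal_quot L} v \in X) by [].
split=> [|u v]; rewrite !piE; first by rewrite raddf0 rpred0.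
by move=> uX vX; rewrite raddfB rpredB.
Qed.

HB.instance Definition _ :=
  GRing.isZmodClosed.Build 'rV[R[i]]_2 overlattice overlattice_zmod_closed.

Definition isogeny (a : {ideal_quot L}) : {ideal_quot overlattice} :=
  \pi_{ideal_quot overlattice} (repr a).

End QuotientIsogeny.

Arguments isogeny {R L} X a.

(* The map [-1] o t_x. *)
Definition neg_translate (A : zmodType) (x a : A) : A := - (a + x).

(* Main.v *)
(** Put M = Lambda'.  A nonzero section forces E to be integral on M, and the
    index d of Lambda in M forces E to be unimodular there, so M has a
    symplectic basis e1, e2, f1, f2 adapted to V1 and V2.  A section of the
    bundle of characteristic 0 is determined by one Fourier coefficient along
    the real torus spanned by e1, e2 (translations by f1, f2 permute the Fourier
    coefficients transitively); that coefficient vanishes for the odd part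
    theta(v) - theta(-v), so theta is even.  Independence of the coefficient of
    the chosen translate of the torus is a Cauchy-Goursat argument, done with
    dyadic Riemann sums.  For l in M, evenness and quasi-periodicity give
    theta(l/2) = chi0(l) theta(l/2): so theta vanishes at the 6 half-periods with
    chi0(l) = -1, and at the 10 others a zero would be singular, contradicting
    smoothness.  Finally, as d is odd, the fixed points of -(a + x) on the cover
    correspond to the half-periods mod M. *)

Require Import Defs.
From HB Require Import structures.
From mathcomp Require Import all_boot all_order all_algebra.
From mathcomp Require Import generic_quotient ring_quotient.
From mathcomp Require Import all_classical all_reals all_analysis.
From mathcomp Require Import complex.
From mathcomp Require Import ring lra zify.

Set Implicit Arguments.
Unset Strict Implicit.
Unset Printing Implicit Defensive.

Import Order.TTheory GRing.Theory Num.Theory.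
Import numFieldNormedType.Exports.

Local Open Scope classical_set_scope.
Local Open Scope ring_scope.
Local Open Scope quotient_scope.
Local Open Scope complex_scope.

(** * Dyadic Riemann sums and the Cauchy-Goursat argument *)

(** The Cauchy-Goursat step rests on a closed form: a holomorphic multiple of dz1 dz2 has top degree
    on C^2, so its integral over the torus spanned by e1, e2 does not change under translation.
    [flux] is its integral over the boundary of a cube, with s, t along the torus and u along the
    translation. Holomorphy is given only as differentiability at each point, with no continuity of
    the derivative, hence bisection in place of Stokes. Riemann sums are never shown to converge:
    they are shown to tend to 0, and a nonzero value of the function is refuted by a lower bound
    uniform in the subdivision, obtained from powers of a trigonometric polynomial that peaks at one
    point. The 6 comes from the hyperbolic quadratic form x1 y1 + x2 y2 over F_2, which equals 1 at
    6 of the 16 vectors. The oddness of d acts through dM being contained in Lambda: doubling is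
    then bijective on M / Lambda, so each half-period mod M lifts to exactly one fixed point. *)

Section Bisection.
Variable R : realType.

(** The intervals of length 2^-k are nested, so every left end lies below every right end and the
    supremum of the left ends is in all of them. *)
Lemma nested_halves (x : nat -> R) (b : nat -> bool) :
  (forall k, x k.+1 = x k + (b k)%:R * (2^-1 ^+ k / 2)) ->
  exists p, forall k, x k <= p <= x k + 2^-1 ^+ k.
Proof.
move=> xS.
have r_gt0 k : 0 < (2^-1 : R) ^+ k by rewrite exprn_gt0 // invr_gt0.
have rS k : (2^-1 : R) ^+ k.+1 = 2^-1 ^+ k / 2 by rewrite exprSr.
have lo k m : x k <= x (k + m)%N.
  elim: m => [|m IH]; first by rewrite addn0.
  rewrite addnS xS; have := r_gt0 (k + m)%N; case: (b _) => /= h; lra.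
have hi k m : x (k + m)%N + 2^-1 ^+ (k + m) <= x k + 2^-1 ^+ k.
  elim: m => [|m IH]; first by rewrite addn0.
  rewrite addnS xS rS; have := r_gt0 (k + m)%N; case: (b _) => /= h; lra.
have ub k j : x j <= x k + 2^-1 ^+ k.
  have [le_jk|/ltnW le_kj] := leqP j k.
    rewrite -(subnKC le_jk); have := lo j (k - j)%N.
    have := r_gt0 (j + (k - j))%N; lra.
  rewrite -(subnKC le_kj); have := hi k (j - k)%N.
  have := r_gt0 (k + (j - k))%N; lra.
have hs : has_sup (range x).
  by split; [exists (x 0%N), 0%N|exists (x 0%N + 2^-1 ^+ 0) => _ [j _ <-]].
exists (sup (range x)) => k; apply/andP; split.
  by apply: sup_upper_bound => //; exists k.
by apply: ge_sup => [|_ [j _ <-]]; first exact: hs.1.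
Qed.

(** Compactness of the unit cube in Goursat's form: a cube where [P] fails has an eighth where it
    fails, and the resulting nested cubes shrink to a point, where the local hypothesis is
    contradicted. *)
Lemma cube_bisection (P : R -> R -> R -> R -> Prop) :
  (forall x y z r, 0 < r ->
    (forall i j k : bool, P (x + i%:R * (r / 2)) (y + j%:R * (r / 2))
                            (z + k%:R * (r / 2)) (r / 2)) ->
    P x y z r) ->
  (forall a b c, exists2 d, 0 < d & forall x y z r, 0 < r < d ->
    x <= a <= x + r -> y <= b <= y + r -> z <= c <= z + r -> P x y z r) ->
  P 0 0 0 1.
Proof.
move=> Psplit Ploc; apply: contrapT => nP.
(* Stated as an implication, so that the choice of an eighth is total, also on cubes where [P]
   holds. *)
pose Q (u : R * R * R * R) (v : bool * bool * bool) :=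
  let: (x, y, z, r) := u in let: (i, j, k) := v in 0 < r ->
  ~ P x y z r -> ~ P (x + i%:R * (r / 2)) (y + j%:R * (r / 2))
                     (z + k%:R * (r / 2)) (r / 2).
have /choice[f fP] : forall u, exists v, Q u v.
  move=> [[[x y] z] r].
  apply: contrapT => /forallNP nsub.
  have r0 : 0 < r.
    by apply: contrapT => nr; apply: (nsub (true, true, true)).
  have nPr : ~ P x y z r.
    by move=> Pr; apply: (nsub (true, true, true)).
  apply: nPr; apply: Psplit => // i j k; apply: contrapT => nPs.
  by apply: (nsub (i, j, k)).
pose step k (u : R * R * R) : R * R * R :=
  let: (x, y, z) := u in let r := 2^-1 ^+ k in
  let: (i, j, l) := f (x, y, z, r) in
  (x + i%:R * (r / 2), y + j%:R * (r / 2), z + l%:R * (r / 2)).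
pose s := fix s k := if k is k'.+1 then step k' (s k') else (0, 0, 0) : R * R * R.
pose bits k := f ((s k).1.1, (s k).1.2, (s k).2, 2^-1 ^+ k).
have sS k : [/\ (s k.+1).1.1 = (s k).1.1 + (bits k).1.1%:R * (2^-1 ^+ k / 2),
   (s k.+1).1.2 = (s k).1.2 + (bits k).1.2%:R * (2^-1 ^+ k / 2) &
   (s k.+1).2 = (s k).2 + (bits k).2%:R * (2^-1 ^+ k / 2)].
  by rewrite /= /bits /step; case: (s k) => [[x y] z] /=; case: (f _) => [[i j] l].
have r_gt0 k : 0 < (2^-1 : R) ^+ k by rewrite exprn_gt0 // invr_gt0.
have nPs k : ~ P (s k).1.1 (s k).1.2 (s k).2 (2^-1 ^+ k).
  elim: k => [|k IH]; first by rewrite expr0.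
  have [-> -> ->] := sS k.
  have := fP ((s k).1.1, (s k).1.2, (s k).2, 2^-1 ^+ k).
  rewrite -/(bits k) /Q exprSr; case: (bits k) => [[i j] l] /=.
  by apply.
have [a aP] : exists a, forall k, (s k).1.1 <= a <= (s k).1.1 + 2^-1 ^+ k.
  by apply: (@nested_halves _ (fun k => (bits k).1.1)) => k; case: (sS k).
have [b bP] : exists b, forall k, (s k).1.2 <= b <= (s k).1.2 + 2^-1 ^+ k.
  by apply: (@nested_halves _ (fun k => (bits k).1.2)) => k; case: (sS k).
have [c cP] : exists c, forall k, (s k).2 <= c <= (s k).2 + 2^-1 ^+ k.
  by apply: (@nested_halves _ (fun k => (bits k).2)) => k; case: (sS k).
have [d d0 dP] := Ploc a b c.
have [k kd] : exists k, (2^-1 : R) ^+ k < d.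
  have /cvgrPdist_lt/(_ _ d0)[k _ /(_ k (leqnn k))] :
    (fun k => (2^-1 : R) ^+ k) @ \oo --> (0 : R).
    by apply: cvg_expr; rewrite ger0_norm ?invr_ge0// invf_lt1 ?ltr1n.
  by rewrite /= sub0r normrN ger0_norm ?ltW//; exists k.
by apply: (nPs k); apply: dP => //; rewrite r_gt0.
Qed.

End Bisection.

Section RiemannSums.
Variable R : realType.
Local Notation C := R[i].

(* Riemann sum of g on [x, x + r[ for the subdivision into 2 ^ n intervals;
   this recursive form makes it additive under bisection. *)
Fixpoint mu (n : nat) (g : R -> C) (x r : R) : C :=
  if n is n'.+1 then mu n' g x (r / 2) + mu n' g (x + r / 2) (r / 2)
  else r%:C * g x.

Definition mu2 (n : nat) (phi : R -> R -> C) (x y r : R) : C :=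
  mu n (fun s => mu n (phi s) y r) x r.

Lemma muD n (g h : R -> C) x r : mu n (fun t => g t + h t) x r = mu n g x r + mu n h x r.
Proof. by elim: n x r => [|n IH] x r /=; rewrite ?mulrDr// !IH addrACA. Qed.

Lemma muZ n (c : C) (g : R -> C) x r : mu n (fun t => c * g t) x r = c * mu n g x r.
Proof. by elim: n x r => [|n IH] x r /=; rewrite ?IH ?mulrDr// mulrCA. Qed.

Lemma mu_cst n (c : C) x r : mu n (fun=> c) x r = r%:C * c.
Proof.
by elim: n x r => //= n IH x r; rewrite !IH -mulrDl -rmorphD/= -splitr.
Qed.

Lemma mu_norm_le n (g : R -> C) (x r : R) (B : C) : 0 < r ->
  (forall t, x <= t < x + r -> `|g t| <= B) -> `|mu n g x r| <= r%:C * B.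
Proof.
elim: n x r => [|n IH] x r r0 gB /=.
  have r0C : 0 < r%:C by rewrite ltcR.
  rewrite normrM (ger0_norm (ltW r0C)). rewrite (ler_pM2l r0C).
  by apply: gB; rewrite lexx/= ltrDl.
have r20 : 0 < r / 2 by rewrite divr_gt0.
have -> : r%:C * B = (r / 2)%:C * B + (r / 2)%:C * B.
  by rewrite -mulrDl -rmorphD/= -splitr.
apply: le_trans (ler_normD _ _) _; apply: lerD; apply: IH => // t /andP[h1 h2].
  by apply: gB; apply/andP; split; lra.
by apply: gB; apply/andP; split; lra.
Qed.

Lemma mu2D n f g x y r :
  mu2 n (fun s t => f s t + g s t) x y r = mu2 n f x y r + mu2 n g x y r.
Proof. by rewrite /mu2 -muD; congr mu; apply/funext => s; rewrite -muD. Qed.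

Lemma mu2Z n (c : C) f x y r : mu2 n (fun s t => c * f s t) x y r = c * mu2 n f x y r.
Proof. by rewrite /mu2 -muZ; congr mu; apply/funext => s; rewrite -muZ. Qed.

Lemma mu2B n f g x y r :
  mu2 n (fun s t => f s t - g s t) x y r = mu2 n f x y r - mu2 n g x y r.
Proof.
rewrite -[in RHS]mulN1r -mu2Z -mu2D; congr mu2.
by apply/funext => s; apply/funext => t; rewrite mulN1r.
Qed.

Lemma mu2_cst n (c : C) x y r : mu2 n (fun _ _ => c) x y r = (r ^+ 2)%:C * c.
Proof.
rewrite /mu2 (_ : (fun _ => _) = fun=> r%:C * c); last first.
  by apply/funext => s; rewrite mu_cst.
by rewrite mu_cst mulrA -rmorphM.
Qed.

Lemma mu2_norm_le n (f : R -> R -> C) (x y r : R) (B : C) : 0 < r ->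
  (forall s t, x <= s < x + r -> y <= t < y + r -> `|f s t| <= B) ->
  `|mu2 n f x y r| <= (r ^+ 2)%:C * B.
Proof.
move=> r0 fB; rewrite expr2 rmorphM -mulrA; apply: mu_norm_le => // s sx.
by apply: mu_norm_le => // t; apply: fB.
Qed.

Lemma mu2S n f x y r : mu2 n.+1 f x y r =
  mu2 n f x y (r / 2) + mu2 n f x (y + r / 2) (r / 2) +
  (mu2 n f (x + r / 2) y (r / 2) + mu2 n f (x + r / 2) (y + r / 2) (r / 2)).
Proof. by rewrite /mu2 /= !muD. Qed.

(* The flux of (-w1 phi, -w2 phi, phi) out of a cube. *)
Definition flux n (phi : R -> R -> R -> C) (w1 w2 : C) x y z r : C :=
  (mu2 n (fun s t => phi s t (z + r)) x y r - mu2 n (fun s t => phi s t z) x y r)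
  - w1 * (mu2 n (phi (x + r)) y z r - mu2 n (phi x) y z r)
  - w2 * (mu2 n (fun s => phi s (y + r)) x z r - mu2 n (fun s => phi s y) x z r).

(** A sum of depth n + 1 on a face is exactly the sum of those of depth n on its quarters, and the
    inner faces of the eight cubes cancel in pairs. *)
Lemma fluxS n phi w1 w2 x y z r : flux n.+1 phi w1 w2 x y z r =
  \sum_(i : bool) \sum_(j : bool) \sum_(k : bool)
     flux n phi w1 w2 (x + i%:R * (r / 2)) (y + j%:R * (r / 2))
                            (z + k%:R * (r / 2)) (r / 2).
Proof.
have h (u : R) : u + r / 2 + r / 2 = u + r by rewrite -addrA -splitr.
by rewrite !big_bool /flux !mu2S /= !mul1r !mul0r !addr0 !h; ring.
Qed.

Lemma flux_periodic n (phi : R -> R -> R -> C) (w1 w2 : C) :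
  phi 1 = phi 0 -> (forall s, phi s 1 = phi s 0) ->
  flux n phi w1 w2 0 0 0 1 =
    mu2 n (fun s t => phi s t 1) 0 0 1 - mu2 n (fun s t => phi s t 0) 0 0 1.
Proof.
move=> phi1 phi2; rewrite /flux !add0r phi1.
have -> : (fun s => phi s 1) = (fun s => phi s 0) by apply/funext.
by rewrite !subrr !mulr0 !subr0.
Qed.

(* Goursat's bisection: on a small cube phi is affine up to a small error, and
   the relation between the partial derivatives makes the flux of an affine
   function vanish. *)
Lemma flux_cvg0 (phi : R -> R -> R -> C) (w1 w2 : C) :
  (forall (a b c : R) (e : C), 0 < e -> exists (al be : C) (d : R), 0 < d /\
    forall s t u m : R, `|s - a| <= m -> `|t - b| <= m -> `|u - c| <= m -> m < d ->
    `|phi s t u - (phi a b c + (s - a)%:C * al + (t - b)%:C * be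
                   + (u - c)%:C * (w1 * al + w2 * be))| <= e * m%:C) ->
  forall e : C, 0 < e -> exists N, forall n, (N <= n)%N ->
    `|flux n phi w1 w2 0 0 0 1| <= e.
Proof.
move=> dphi e e0.
(* The bound is proportional to the volume, so that eight half-size cubes add up to it exactly. *)
pose P x y z r := exists N, forall n, (N <= n)%N ->
  `|flux n phi w1 w2 x y z r| <= (r ^+ 3)%:C * e.
suff : P 0 0 0 1 by rewrite /P expr1n mul1r.
apply: cube_bisection => [x y z r r0 Psub|a b c].
  have /choice[N NP] : forall v : bool * bool * bool, exists N,
      forall n, (N <= n)%N -> `|flux n phi w1 w2 (x + v.1.1%:R * (r / 2))
        (y + v.1.2%:R * (r / 2)) (z + v.2%:R * (r / 2)) (r / 2)|
        <= ((r / 2) ^+ 3)%:C * e.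
    by move=> [[i j] k]; apply: Psub.
  (* The sum of the eight thresholds dominates each of them; the successor pays for the level
     consumed by [fluxS]. *)
  exists (\sum_v N v).+1 => -[//|n]; rewrite ltnS => Nn.
  have -> : (r ^+ 3)%:C * e = \sum_(i : bool) \sum_(j : bool) \sum_(k : bool)
      ((r / 2) ^+ 3)%:C * e.
    by rewrite !big_bool /= -!mulrDl -!rmorphD /=; congr (_%:C * _); field.
  rewrite fluxS; apply: le_trans (ler_norm_sum _ _ _) _; apply: ler_sum => i _.
  apply: le_trans (ler_norm_sum _ _ _) _; apply: ler_sum => j _.
  apply: le_trans (ler_norm_sum _ _ _) _; apply: ler_sum => k _.
  apply: (NP (i, j, k)); apply: leq_trans Nn.
  by rewrite (bigD1 (i, j, k)) //= leq_addr.
(* [K] is the total weight of the three pairs of opposite faces; the further factor 2 below is there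
   because each pair compares two values of [phi], each with its own error. *)
pose K : C := 1 + `|w1| + `|w2|.
have K0 : 0 < K by rewrite /K -addrA ltr_pwDl// addr_ge0.
have e'0 : 0 < e / 2 / K by rewrite !divr_gt0.
have [al [be [d [d0 dP]]]] := dphi a b c _ e'0.
exists d => // x y z r /andP[r0 rd] xa yb zc; exists 0%N => n _.
set ga := w1 * al + w2 * be in dP.
pose A s t u := phi a b c + (s - a)%:C * al + (t - b)%:C * be + (u - c)%:C * ga.
have phiA s t u : x <= s <= x + r -> y <= t <= y + r -> z <= u <= z + r ->
    `|phi s t u - A s t u| <= e / 2 / K * r%:C.
  move=> hs ht hu; apply: dP => //; rewrite ler_norml; apply/andP; split; lra.
have face (f g : R -> R -> C) x' y' l :
    (forall s t, x' <= s < x' + r -> y' <= t < y' + r ->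
      `|f s t - g s t - r%:C * l| <= e / K * r%:C) ->
    `|mu2 n f x' y' r - mu2 n g x' y' r - (r ^+ 3)%:C * l|
      <= (r ^+ 3)%:C * (e / K).
  move=> fg; have -> : mu2 n f x' y' r - mu2 n g x' y' r - (r ^+ 3)%:C * l =
      mu2 n (fun s t => f s t - g s t - r%:C * l) x' y' r.
    by rewrite !mu2B mu2_cst mulrA -rmorphM -exprSr.
  apply: le_trans (mu2_norm_le _ r0 fg) _.
  by rewrite mulrCA mulrC -rmorphM/= -exprSr.
have incl p q : p <= q < p + r -> p <= q <= p + r by move=> /andP[-> /ltW].
have left p : p <= p <= p + r by rewrite lexx lerDl ltW.
have right p : p <= p + r <= p + r by rewrite lexx lerDl ltW.
have half p q : `|p| <= e / 2 / K * r%:C -> `|q| <= e / 2 / K * r%:C ->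
    `|p - q| <= e / K * r%:C.
  move=> hp hq; apply: le_trans (ler_normB _ _) _.
  have -> : e / K * r%:C = e / 2 / K * r%:C + e / 2 / K * r%:C.
    by rewrite -2!mulrDl -splitr.
  exact: lerD.
have h1 := @face (fun s t => phi s t (z + r)) (fun s t => phi s t z) x y ga.
have h2 := @face (phi (x + r)) (phi x) y z al.
have h3 := @face (fun s => phi s (y + r)) (fun s => phi s y) x z be.
rewrite /flux.
set X := _ - mu2 n (fun s t => phi s t z) x y r.
set Y := _ - mu2 n (phi x) y z r; set Z := _ - mu2 n (fun s => phi s y) x z r.
(* The affine parts may be subtracted freely, since their total vanishes by the choice of [ga]. *)
have -> : X - w1 * Y - w2 * Z = (X - (r ^+ 3)%:C * ga)
  - w1 * (Y - (r ^+ 3)%:C * al) - w2 * (Z - (r ^+ 3)%:C * be).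
  by rewrite /ga; ring.
have -> : (r ^+ 3)%:C * e = (r ^+ 3)%:C * (e / K) +
    `|w1| * ((r ^+ 3)%:C * (e / K)) + `|w2| * ((r ^+ 3)%:C * (e / K)).
  by rewrite /K; field; rewrite -/K gt_eqF.
apply: le_trans (ler_normB _ _) _; apply: lerD; last first.
  rewrite normrM; apply: ler_wpM2l => //; apply: h3 => s u hs hu.
  have -> : phi s (y + r) u - phi s y u - r%:C * be =
     (phi s (y + r) u - A s (y + r) u) - (phi s y u - A s y u).
    by rewrite /A !rmorphB !rmorphD /=; ring.
  by apply: half; apply: phiA => //; apply: incl.
apply: le_trans (ler_normB _ _) _; apply: lerD; last first.
  rewrite normrM; apply: ler_wpM2l => //; apply: h2 => t u ht hu.
  have -> : phi (x + r) t u - phi x t u - r%:C * al =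
     (phi (x + r) t u - A (x + r) t u) - (phi x t u - A x t u).
    by rewrite /A !rmorphB !rmorphD /=; ring.
  by apply: half; apply: phiA => //; apply: incl.
apply: h1 => s t hs ht.
have -> : phi s t (z + r) - phi s t z - r%:C * ga =
   (phi s t (z + r) - A s t (z + r)) - (phi s t z - A s t z).
  by rewrite /A !rmorphB !rmorphD /=; ring.
by apply: half; apply: phiA => //; apply: incl.
Qed.

End RiemannSums.

(** * The complex exponential *)

Section Cexp.
Variable R : realType.
Local Notation C := R[i].
Local Notation V := 'rV[R[i]]_2.

Lemma cexp0 : cexp 0 = 1 :> C.
Proof. by rewrite /cexp /= expR0 cos0 sin0 mul1r. Qed.

Lemma cexpD (z w : C) : cexp (z + w) = cexp z * cexp w.
Proof.
case: z w => [a b] [c d]; rewrite /cexp /= expRD cosD sinD rmorphM /=.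
by simpc; apply/eqP; rewrite eq_complex /=; apply/andP; split; apply/eqP; ring.
Qed.

Lemma cexp_neq0 (z : C) : cexp z != 0.
Proof.
apply/eqP => z0; have := cexpD z (- z); rewrite subrr cexp0 z0 mul0r.
by apply/eqP; rewrite oner_eq0.
Qed.

Lemma real_expansion (f : R -> R) (l : R) : is_derive (0 : R) 1 f l ->
  forall e, 0 < e -> exists2 d, 0 < d &
    forall x, `|x| < d -> `|f x - f 0 - l * x| <= e * `|x|.
Proof.
move=> [df fl] e e0.
have : (fun h => h^-1 *: (f (h *: 1 + 0) - f 0)) @ (0 : R)^' --> l.
  by rewrite -fl; exact: df.
move=> /cvgrPdist_le /(_ e e0) [d /= d0 dP]; exists d => // x xd.
have [->|x0] := eqVneq x 0; first by rewrite mulr0 subrr subr0 normr0 mulr0.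
have /= := dP x _ x0; rewrite /= sub0r normrN => /(_ xd).
rewrite /GRing.scale/= mulr1 addr0 => h.
have -> : f x - f 0 - l * x = - ((l - x^-1 * (f x - f 0)) * x) by field.
by rewrite normrN normrM ler_wpM2r.
Qed.

Lemma normc_le_ReIm (z : C) : `|z| <= (`|complex.Re z| + `|complex.Im z|)%:C.
Proof.
case: z => a b /=; rewrite [a +i* b]complexE /=.
apply: le_trans (ler_normD _ _) _.
by rewrite normrM complexiE normCi mul1r rmorphD !normc_def /= !expr0n /= !addr0 !sqrtr_sqr.
Qed.

Lemma cexp_expansion (e : R) : 0 < e -> exists2 d, 0 < d &
  forall z : C, `|z| < d%:C -> `|cexp z - 1 - z| <= e%:C * `|z|.
Proof.
(* The real and the imaginary part each split into three terms of size at most [e' * m], hence 6.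
   The cap 1 and the radius [e' / 2] below give [|sin b| <= e']. *)
move=> e0; pose e' := Num.min (e / 6) 1.
have e'0 : 0 < e' by rewrite lt_min divr_gt0/=.
have e'e : 6 * e' <= e by rewrite mulrC -ler_pdivlMr// ge_min lexx.
have e'1 : e' <= 1 by rewrite ge_min lexx orbT.
have [d1 d10 d1P] := real_expansion (is_derive_expR 0) e'0.
have [d2 d20 d2P] := real_expansion (is_derive_sin 0) e'0.
have [d3 d30 d3P] := real_expansion (is_derive_cos 0) e'0.
exists (Num.min (Num.min d1 d2) (Num.min d3 (e' / 2))).
  by rewrite !lt_min d10 d20 d30 divr_gt0.
move=> z zd; have [m mE] : exists m : R, `|z| = m%:C by rewrite normc_def; eexists.
have am : `|complex.Re z| <= m by rewrite -lecR -mE normc_ge_Re.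
have bm : `|complex.Im z| <= m.
  rewrite -lecR -mE normc_def lecR -sqrtr_sqr ler_wsqrtr // lerDr; exact: sqr_ge0.
rewrite mE ltcR !lt_min in zd; case/andP: zd => /andP[md1 md2] /andP[md3 me].
rewrite mE; apply: le_trans (normc_le_ReIm _) _; rewrite -rmorphM lecR.
case: z am bm {mE} => a b /= am bm.
have m0 : 0 <= m by apply: le_trans am.
have := d1P a (le_lt_trans am md1); rewrite expR0 mul1r => ha.
have := d2P b (le_lt_trans bm md2); rewrite sin0 cos0 subr0 mul1r => hb.
have := d3P b (le_lt_trans bm md3); rewrite sin0 cos0 oppr0 mul0r subr0 => hc.
rewrite /cexp /=; simpc => /=.
have e'm : e' * m <= 1 * m by rewrite ler_wpM2r.
have {}ha : `|expR a - 1 - a| <= e' * m.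
  by apply: le_trans ha _; rewrite ler_wpM2l// ltW.
have {}hb : `|sin b - b| <= e' * m.
  by apply: le_trans hb _; rewrite ler_wpM2l// ltW.
have {}hc : `|cos b - 1| <= e' * m.
  by apply: le_trans hc _; rewrite ler_wpM2l// ltW.
have sb : `|sin b| <= e'.
  have -> : sin b = (sin b - b) + b by ring.
  by apply: le_trans (ler_normD _ _) _; lra.
have -> : expR a * cos b - 1 - a =
  (expR a - 1 - a) * cos b + (cos b - 1) + a * (cos b - 1) by ring.
have -> : expR a * sin b - b =
  (expR a - 1 - a) * sin b + a * sin b + (sin b - b) by ring.
have P (p q s t : R) : `|p| <= s -> `|q| <= t -> `|p * q| <= s * t.
  by move=> *; rewrite normrM ler_pM.
have h1 := P _ _ _ _ ha (cos_max b).
have h2 := P _ _ _ _ am hc.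
have h3 := P _ _ _ _ ha (sin_max b).
have h4 := P _ _ _ _ am sb.
have h5 : m * (e' * m) <= 1 * (e' * m).
  by rewrite ler_wpM2r ?mulr_ge0// ?ltW//; lra.
have h6 : 6 * e' * m <= e * m by rewrite ler_wpM2r.
have := ler_normD ((expR a - 1 - a) * cos b + (cos b - 1)) (a * (cos b - 1)).
have := ler_normD ((expR a - 1 - a) * cos b) (cos b - 1).
have := ler_normD ((expR a - 1 - a) * sin b + a * sin b) (sin b - b).
have := ler_normD ((expR a - 1 - a) * sin b) (a * sin b).
lra.
Qed.

Lemma differentiable_cexp (z : C) : differentiable (@cexp R : C -> C) z.
Proof.
apply/derivable1_diffP.
apply/cvg_ex; exists (cexp z); apply/cvgrPdist_le => /= e e0.
have [e' e'E] : exists e' : R, e = e'%:C.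
  by case: e e0 => a b; rewrite ltcE /= => /andP[/eqP -> _]; exists a.
have ez0 : 0 < e / `|cexp z| by rewrite divr_gt0 ?normr_gt0 ?cexp_neq0.
have [e2 e2E] : exists e2 : R, e / `|cexp z| = e2%:C.
  by rewrite e'E normc_def -fmorphV -rmorphM; eexists.
move: ez0; rewrite e2E ltcR => e20.
have [d d0 dP] := cexp_expansion e20.
exists d%:C => /=; first by rewrite ltcR.
move=> h /=; rewrite sub0r normrN => hd h0.
have -> : cexp z - h^-1 *: (cexp (h *: 1 + z) - cexp z) =
   - (cexp z * (h^-1 * (cexp h - 1 - h))).
  by rewrite /GRing.scale/= mulr1 cexpD; field.
rewrite normrN (normrM (cexp z)) (normrM h^-1) normfV.
have := dP h hd; rewrite -e2E => hh.
rewrite -ler_pdivlMl ?normr_gt0 ?cexp_neq0// ler_pdivrMl ?normr_gt0//.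
by rewrite [X in _ <= X]mulrC [_^-1 * e]mulrC.
Qed.

Lemma holomorphicM (f h : V -> C) :
  holomorphic f -> holomorphic h -> holomorphic (f * h).
Proof.
by move=> df dh v; apply: differentiableM; [exact: df|exact: dh].
Qed.

Lemma holomorphicD (f h : V -> C) :
  holomorphic f -> holomorphic h -> holomorphic (f + h).
Proof.
by move=> df dh v; apply: differentiableD; [exact: df|exact: dh].
Qed.

Lemma holomorphic_cst (c : C) : holomorphic (cst c : V -> C).
Proof. by move=> v; exact: differentiable_cst. Qed.

Lemma holomorphic_coord (i : 'I_1) (j : 'I_2) : holomorphic (fun v : V => v i j).
Proof. by move=> v; exact: differentiable_coord. Qed.

Lemma holomorphic_cexp (f : V -> C) :
  holomorphic f -> holomorphic (fun v => cexp (f v)).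
Proof.
move=> df v; apply: (differentiable_comp (df v)); exact: differentiable_cexp.
Qed.

Lemma holomorphic_opp (f : V -> C) : holomorphic f -> holomorphic (fun v => f (- v)).
Proof. by move=> df v; apply: (differentiable_comp (f := -%R)). Qed.

End Cexp.

(** * Exact symmetries of Riemann sums of periodic functions *)

Section Reflection.
Variable R : realType.
Local Notation C := R[i].

Lemma muE n (g : R -> C) x r : mu n g x r =
  \sum_(0 <= k < 2 ^ n) (r / 2 ^+ n)%:C * g (x + k%:R * (r / 2 ^+ n)).
Proof.
elim: n x r => [|n IH] x r /=; first by rewrite big_nat1 mul0r addr0 divr1.
rewrite !IH expnS mul2n -addnn [in RHS](big_cat_nat _ (n := 2 ^ n)) ?leq_addr//=.
have E : r / 2 / 2 ^+ n = r / 2 ^+ n.+1 by rewrite exprS; field; rewrite expf_neq0.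
have E2 : r / 2 = (2 ^ n)%:R * (r / 2 ^+ n.+1).
  by rewrite natrX exprS; field; rewrite expf_neq0.
rewrite E -[X in \sum_(X <= i < _ + _) _](add0n (2 ^ n)%N) big_addn addnK.
congr +%R; apply: eq_bigr => k _.
by rewrite E2 natrD mulrDl addrA addrAC.
Qed.

(** Reflection exchanges left and right endpoints of the subdivision; by periodicity both sums have
    the same terms, so the equality is exact at every depth. *)
Lemma mu_opp n (g : R -> C) : (forall t, g (t + 1) = g t) ->
  mu n (fun t => g (- t)) 0 1 = mu n g 0 1.
Proof.
move=> g1; rewrite !muE -!mulr_sumr; congr (_ * _).
rewrite big_nat_rev /=.
have g10 : g 1 = g 0 by rewrite -[in LHS](add0r 1) g1.
have -> : \sum_(0 <= k < 2 ^ n) g (0 + k%:R * (1 / 2 ^+ n)) =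
  \sum_(0 <= k < 2 ^ n) g (k.+1%:R * (1 / 2 ^+ n)).
  (* The telescoping sum from [g 0] to [g 1] is zero, which shifts the sample points by one. *)
  have := @telescope_sumr _ 0%N (2 ^ n)%N (fun k => g (k%:R * (1 / 2 ^+ n))).
  move=> /(_ (leq0n _)); rewrite mul0r natrX mulrA mulr1 divff ?expf_neq0// g10 subrr.
  rewrite sumrB => /eqP; rewrite subr_eq0 => /eqP ->.
  by apply: eq_bigr => k _; rewrite add0r.
apply: eq_big_nat => k /andP[_ kn]; rewrite -[LHS]g1; congr g.
rewrite add0n natrB// natrX; field; exact: expf_neq0.
Qed.

Lemma mu2_odd n (phi : R -> R -> C) :
  (forall s t, phi (s + 1) t = phi s t) -> (forall s t, phi s (t + 1) = phi s t) ->
  (forall s t, phi (- s) (- t) = - phi s t) -> mu2 n phi 0 0 1 = 0.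
Proof.
move=> p1 p2 po; suff h : mu2 n phi 0 0 1 = - mu2 n phi 0 0 1.
  by apply/eqP; rewrite -[_ == 0]/(false || _) -(mulrn_eq0 _ 2) mulr2n {1}h addNr.
rewrite {1}/mu2 -mu_opp => [|s]; last by congr mu; apply/funext => t; rewrite p1.
rewrite -mulN1r -mu2Z; congr mu; apply/funext => s.
by rewrite -mu_opp => [|t] //; congr mu; apply/funext => t; rewrite po mulN1r.
Qed.

End Reflection.

(** * Uniqueness of Fourier coefficients *)

Section Concentration.
Variable R : realType.
Local Notation C := R[i].

Lemma Re_mu_ge n (g : R -> C) (x r A : R) : 0 < r ->
  (forall t, x <= t < x + r -> A <= complex.Re (g t)) ->
  r * A <= complex.Re (mu n g x r).
Proof.
elim: n x r => [|n IH] x r r0 gA /=.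
  have := gA x; rewrite lexx ltrDl r0 => /(_ isT).
  by case: (g x) => a b /=; rewrite mul0r subr0 ler_pM2l.
rewrite raddfD /= [X in X * A]splitr mulrDl.
by apply: lerD; apply: IH => [|t /andP[h1 h2]]; rewrite ?divr_gt0//;
  apply: gA; apply/andP; split; lra.
Qed.

Lemma Re_mu_ge0 n (g : R -> C) (x r : R) : 0 < r ->
  (forall t, x <= t < x + r -> 0 <= complex.Re (g t)) ->
  0 <= complex.Re (mu n g x r).
Proof. by move=> r0 /(Re_mu_ge n r0); rewrite mulr0. Qed.

Lemma Re_mu_left n k (g : R -> C) (x r : R) : 0 < r ->
  (forall t, x <= t < x + r -> 0 <= complex.Re (g t)) ->
  complex.Re (mu n g x (r / 2 ^+ k)) <= complex.Re (mu (n + k) g x r).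
Proof.
elim: k r => [|k IH] r r0 g0; first by rewrite divr1 addn0.
have r20 : 0 < r / 2 by rewrite divr_gt0.
rewrite addnS /= raddfD /= -[leLHS]addr0; apply: lerD; last first.
  by apply: Re_mu_ge0 => // t /andP[h1 h2]; apply: g0; apply/andP; split; lra.
have -> : r / 2 ^+ k.+1 = r / 2 / 2 ^+ k.
  by rewrite exprS; field; rewrite expf_neq0.
by apply: IH => // t /andP[h1 h2]; apply: g0; apply/andP; split; lra.
Qed.

(** The interval kept is the leftmost dyadic piece of the right half. The peak of [kernel] is placed
    at 1/2 so that such a piece starts there. *)
Lemma Re_mu_localized n k (g : R -> C) (A : R) :
  (forall t, 0 <= t < 1 -> 0 <= complex.Re (g t)) ->
  (forall t, 2^-1 <= t < 2^-1 + 2^-1 / 2 ^+ k -> A <= complex.Re (g t)) ->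
  2^-1 / 2 ^+ k * A <= complex.Re (mu (n + k).+1 g 0 1).
Proof.
move=> g0 gA; rewrite /= raddfD /= add0r div1r -[leLHS]add0r.
apply: lerD.
  apply: Re_mu_ge0; rewrite ?invr_gt0// => t /andP[h1 h2].
  by apply: g0; apply/andP; split; lra.
apply: le_trans (Re_mu_left _ _ _ _); last 2 first.
- by rewrite invr_gt0.
- by move=> t /andP[h1 h2]; apply: g0; apply/andP; split; lra.
by apply: Re_mu_ge => //; rewrite divr_gt0 ?invr_gt0 ?exprn_gt0.
Qed.

Lemma Re_mu2_localized n k (g : R -> R -> C) (A : R) :
  (forall s t, 0 <= s < 1 -> 0 <= t < 1 -> 0 <= complex.Re (g s t)) ->
  (forall s t, 2^-1 <= s < 2^-1 + 2^-1 / 2 ^+ k ->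
     2^-1 <= t < 2^-1 + 2^-1 / 2 ^+ k -> A <= complex.Re (g s t)) ->
  (2^-1 / 2 ^+ k) ^+ 2 * A <= complex.Re (mu2 (n + k).+1 g 0 0 1).
Proof.
move=> g0 gA; rewrite expr2 -mulrA; apply: Re_mu_localized => s hs.
  by apply: Re_mu_ge0 => // t; rewrite add0r; apply: g0.
apply: Re_mu_localized => t ht; last exact: gA.
apply: g0 => //; case/andP: hs => h1 h2; apply/andP; split; first lra.
apply: lt_le_trans h2 _.
have : 2^-1 / 2 ^+ k <= 2^-1 :> R.
  by rewrite ler_pdivrMr ?exprn_gt0// ler_peMr// exprn_ege1// ler1n.
lra.
Qed.

Lemma pow_dominates (q q' B c : R) : 0 <= q < q' -> 0 < c ->
  exists m, B * q ^+ m < c * q' ^+ m.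
Proof.
move=> /andP[q0 qq'] c0; have q'0 : 0 < q' by apply: le_lt_trans qq'.
have : (fun m => B * (q / q') ^+ m) @ \oo --> (B * 0 : R).
  apply: cvgMr; apply: cvg_expr.
  by rewrite ger0_norm ?divr_ge0 ?(ltW q'0)// ltr_pdivrMr// mul1r.
rewrite mulr0 => /cvgrPdist_lt/(_ _ c0)[m _ /(_ m (leqnn m))] /=.
rewrite sub0r normrN => /(le_lt_trans (ler_norm _)) h; exists m.
by rewrite -ltr_pdivrMr ?exprn_gt0// -mulrA -expr_div_n.
Qed.

(** Outside the box the real part of the integrand is at least [- B * q ^+ m], so adding this
    constant back makes it nonnegative on the whole square. The dyadic subsquare alone then
    contributes its area times [q' ^+ m / 2], which exceeds the constant for a suitable [m]. *)
Lemma mu2_kernel_ge (psi : R -> R -> C) (k : R -> R -> R) (B d q q' : R) j :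
  (forall s t, 0 <= s < 1 -> 0 <= t < 1 -> `|psi s t| <= B%:C) ->
  (forall s t, `|s - 2^-1| < d -> `|t - 2^-1| < d ->
     2^-1 <= complex.Re (psi s t)) ->
  (forall s t, 0 <= k s t) ->
  (forall s t, 0 <= s < 1 -> 0 <= t < 1 ->
     ~ (`|s - 2^-1| < d /\ `|t - 2^-1| < d) -> k s t <= q) ->
  0 <= q < q' -> 2^-1 / 2 ^+ j < d ->
  (forall s t, 2^-1 <= s < 2^-1 + 2^-1 / 2 ^+ j ->
     2^-1 <= t < 2^-1 + 2^-1 / 2 ^+ j -> q' <= k s t) ->
  exists m, exists2 c, 0 < c & forall n, (j < n)%N ->
    c <= complex.Re (mu2 n (fun s t => psi s t * (k s t ^+ m)%:C) 0 0 1).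
Proof.
move=> psiB psi1 k0 kq /andP[q0 qq'] jd kq'.
have q'0 : 0 < q' by apply: le_lt_trans qq'.
have B0 : 0 <= B.
  have := psiB 0 0; rewrite lexx ltr01 => /(_ isT isT)/(le_trans (normr_ge0 _)).
  by rewrite lecR.
have w0 : 0 < (2^-1 / 2 ^+ j) ^+ 2 / 2 :> R.
  by rewrite divr_gt0 ?exprn_gt0 ?divr_gt0 ?invr_gt0 ?exprn_gt0.
have [|m mP] := @pow_dominates q q' B _ _ w0; first by rewrite q0.
exists m, ((2^-1 / 2 ^+ j) ^+ 2 / 2 * q' ^+ m - B * q ^+ m).
  by rewrite subr_gt0.
move=> n jn; rewrite -(subnK jn) addnS.
pose g s t : C := psi s t * (k s t ^+ m)%:C + (B * q ^+ m)%:C.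
have Reg s t : complex.Re (g s t) = complex.Re (psi s t) * k s t ^+ m + B * q ^+ m.
  by rewrite /g; case: (psi s t) => a b /=; rewrite mulr0 subr0.
have in_box s t : `|s - 2^-1| < d -> `|t - 2^-1| < d ->
    k s t ^+ m / 2 <= complex.Re (g s t).
  move=> hs ht; rewrite Reg.
  apply: ler_wpDr; first by rewrite mulr_ge0// exprn_ge0.
  by rewrite mulrC ler_wpM2r ?exprn_ge0// psi1.
have ge0 s t : 0 <= s < 1 -> 0 <= t < 1 -> 0 <= complex.Re (g s t).
  move=> hs ht; case: (pselect (`|s - 2^-1| < d /\ `|t - 2^-1| < d)) => [[h1 h2]|nh].
    by apply: le_trans (in_box _ _ h1 h2); rewrite divr_ge0 ?exprn_ge0.
  rewrite Reg -[leLHS](subrr (B * q ^+ m)) addrC lerD2r.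
  have kle : k s t ^+ m <= q ^+ m.
    by apply: lerXn2r; rewrite ?nnegrE// kq.
  have Bpsi : `|complex.Re (psi s t)| <= B.
    by rewrite -lecR; apply: le_trans (normc_ge_Re _) (psiB _ _ hs ht).
  rewrite -lerN2 opprK; apply: le_trans (ler_norm _) _.
  by rewrite normrN normrM ler_pM// ger0_norm ?exprn_ge0.
have := @Re_mu2_localized (n - j.+1) j g (q' ^+ m / 2) ge0.
rewrite (_ : mu2 _ g 0 0 1 = mu2 (n - j.+1 + j).+1
   (fun s t => psi s t * (k s t ^+ m)%:C) 0 0 1 + (B * q ^+ m)%:C); last first.
  by rewrite /g mu2D mu2_cst expr1n mul1r.
rewrite raddfD /= -lerBlDr => h.
have -> : (2^-1 / 2 ^+ j) ^+ 2 / 2 * q' ^+ m = (2^-1 / 2 ^+ j) ^+ 2 * (q' ^+ m / 2).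
  by ring.
apply: h => s t hs ht.
have near_half u : 2^-1 <= u < 2^-1 + 2^-1 / 2 ^+ j -> `|u - 2^-1| < d.
  by move=> /andP[h1 h2]; rewrite ger0_norm; lra.
apply: le_trans (in_box _ _ (near_half _ hs) (near_half _ ht)).
rewrite ler_pM2r ?invr_gt0//; apply: lerXn2r; rewrite ?nnegrE ?(ltW q'0)//.
exact: kq'.
Qed.

(** It takes values in [0, 1] and reaches 1 on the unit square only at (1/2, 1/2). Being a
    trigonometric polynomial with frequencies 0 and 1, its powers can be tested against Fourier
    coefficients. *)
Definition kernel (s t : R) : R := (2 - cos (2 * pi * s) - cos (2 * pi * t)) / 4.

Lemma kernel_ge0 s t : 0 <= kernel s t.
Proof.
have := cos_le1 (2 * pi * s); have := cos_le1 (2 * pi * t).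
by rewrite /kernel; lra.
Qed.

Lemma kernel_shift x y :
  kernel (2^-1 + x) (2^-1 + y) = (2 + cos (2 * pi * x) + cos (2 * pi * y)) / 4.
Proof.
have h u : cos (2 * pi * (2^-1 + u)) = - cos (2 * pi * u) :> R.
  by rewrite -cosDpi; congr cos; field.
by rewrite /kernel !h !opprK.
Qed.

Lemma cos_norm (u : R) : cos `|u| = cos u.
Proof. by case: (ger0P u) => // _; rewrite cosN. Qed.

Lemma kernel_far d : 0 < d <= 2^-1 -> exists2 q, 0 <= q < 1 &
  forall s t, 0 <= s < 1 -> 0 <= t < 1 ->
    ~ (`|s - 2^-1| < d /\ `|t - 2^-1| < d) -> kernel s t <= q.
Proof.
move=> /andP[d0 d1]; have p0 := @pi_gt0 R.
have in_pi u : 0 <= u <= 2^-1 -> 2 * pi * u \in `[0, pi : R].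
  move=> /andP[u0 u1]; rewrite in_itv /=; apply/andP; split.
    by rewrite !mulr_ge0// ltW.
  have : pi * u <= pi * 2^-1 :> R by rewrite ler_wpM2l // ltW.
  by have := p0; lra.
have cd1 : cos (2 * pi * d) < 1 :> R.
  have dpi : 2 * pi * d \in `[0, pi : R] by rewrite in_pi// d1 ltW.
  have zpi : 0 \in `[0, pi : R] by rewrite in_itv /= lexx ltW.
  by rewrite -[ltRHS](@cos0 R) ltr_cos// !mulr_gt0.
have cdN1 : -1 <= cos (2 * pi * d) :> R by exact: cos_geN1.
exists ((3 + cos (2 * pi * d)) / 4); first by apply/andP; split; lra.
have far u : 0 <= u < 1 -> d <= `|u - 2^-1| ->
    cos (2 * pi * (u - 2^-1)) <= cos (2 * pi * d) :> R.
  move=> hu du; rewrite -[leLHS]cos_norm normrM ger0_norm; last first.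
    by rewrite mulr_ge0 ?ltW.
  have dpi : 2 * pi * d \in `[0, pi : R] by rewrite in_pi// d1 ltW.
  have upi : 2 * pi * `|u - 2^-1| \in `[0, pi : R].
    rewrite in_pi// normr_ge0 ler_norml.
    by case/andP: hu => *; apply/andP; split; lra.
  by rewrite leNgt ltr_cos// -leNgt ler_pM2l ?mulr_gt0.
move=> s t hs ht nst.
have -> : kernel s t = kernel (2^-1 + (s - 2^-1)) (2^-1 + (t - 2^-1)).
  by congr kernel; ring.
rewrite kernel_shift.
have := cos_le1 (2 * pi * (s - 2^-1)); have := cos_le1 (2 * pi * (t - 2^-1)).
have [ds|ds] := leP d `|s - 2^-1|; first by have := far s hs ds; lra.
have [dt|dt] := leP d `|t - 2^-1|; first by have := far t ht dt; lra.
by case: nst.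
Qed.

Lemma kernel_near (q : R) : q < 1 -> exists2 d, 0 < d &
  forall s t, `|s - 2^-1| < d -> `|t - 2^-1| < d -> q <= kernel s t.
Proof.
move=> q1; have [d0 d00 dP] := real_expansion (is_derive_cos 0) (ltr01 : 0 < (1 : R)).
have p0 := @pi_gt0 R.
(* Then each cosine in [kernel_shift] is at least 2q - 1, and (2 + 2(2q - 1)) / 4 = q. *)
pose b := Num.min d0 (2 * (1 - q)).
have b0 : 0 < b by rewrite lt_min d00 mulr_gt0// subr_gt0.
exists (b / (2 * pi)); first by rewrite divr_gt0// mulr_gt0.
have near u : `|u - 2^-1| < b / (2 * pi) -> 2 * q - 1 <= cos (2 * pi * (u - 2^-1)).
  rewrite ltr_pdivlMr ?mulr_gt0// mulrC => hu.
  have {}hu : `|2 * pi * (u - 2^-1)| < b by rewrite normrM ger0_norm// mulr_ge0// ltW.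
  move: (hu); rewrite lt_min => /andP[/dP h1 h2].
  move: h1; rewrite sin0 oppr0 mul0r subr0 cos0 mul1r ler_norml => /andP[h1 _].
  lra.
move=> s t hs ht.
have -> : kernel s t = kernel (2^-1 + (s - 2^-1)) (2^-1 + (t - 2^-1)).
  by congr kernel; ring.
by rewrite kernel_shift; have := near s hs; have := near t ht; lra.
Qed.

(** The constant [c] does not depend on [n]; this is what contradicts sums tending to 0. The level
    (1 + q) / 2 is chosen strictly between the bound [q] far from the peak and the peak value 1. *)
Lemma mu2_kernel_lower_bound (psi : R -> R -> C) (B d : R) : 0 < d ->
  (forall s t, 0 <= s < 1 -> 0 <= t < 1 -> `|psi s t| <= B%:C) ->
  (forall s t, `|s - 2^-1| < d -> `|t - 2^-1| < d ->
     2^-1 <= complex.Re (psi s t)) ->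
  exists m, exists2 c, 0 < c & exists N, forall n, (N <= n)%N ->
    c <= complex.Re (mu2 n (fun s t => psi s t * (kernel s t ^+ m)%:C) 0 0 1).
Proof.
move=> d0 psiB psi1; pose d' := Num.min d 2^-1.
have d'0 : 0 < d' <= 2^-1 by rewrite lt_min d0 invr_gt0 ltr0n ge_min lexx orbT.
have [q /andP[q0 q1] qP] := kernel_far d'0.
have q'1 : (1 + q) / 2 < 1 by lra.
have [b b0 bP] := kernel_near q'1.
have [j jP] : exists j, 2^-1 / 2 ^+ j < Num.min d' b.
  have db0 : 0 < Num.min d' b by rewrite lt_min b0 andbT; case/andP: d'0.
  have [|m] := @pow_dominates 2^-1 1 1 _ _ db0; first by apply/andP; split; lra.
  rewrite mul1r expr1n mulr1 => h; exists m.
  rewrite exprVn in h; apply: le_lt_trans h.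
  by rewrite ler_piMl ?invr_ge0 ?exprn_ge0//; lra.
move: jP; rewrite lt_min => /andP[jd jb].
have [||||||m [c c0 cP]] := @mu2_kernel_ge psi kernel B d' q ((1 + q) / 2) j psiB.
- by move=> s t; rewrite !lt_min => /andP[hs _] /andP[ht _]; apply: psi1.
- by move=> s t; apply: kernel_ge0.
- exact: qP.
- by apply/andP; split; lra.
- by [].
- have near u : 2^-1 <= u < 2^-1 + 2^-1 / 2 ^+ j -> `|u - 2^-1| < b.
    by move=> /andP[h1 h2]; rewrite ger0_norm; lra.
  by move=> s t /near hs /near ht; apply: bP.
by exists m, c => //; exists j.+1.
Qed.

End Concentration.

(** * Vanishing of odd quasi-periodic functions *)

Section Vanishing.
Variable R : realType.
Local Notation C := R[i].
Local Notation V := 'rV[R[i]]_2.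

Lemma pos_complex (e : C) : 0 < e -> exists2 r : R, 0 < r & e = r%:C.
Proof.
by case: e => a b; rewrite ltcE /= => /andP[/eqP -> a0]; exists a.
Qed.

Lemma norm_complex (z : C) : exists2 r : R, 0 <= r & `|z| = r%:C.
Proof. by rewrite normc_def; eexists; last reflexivity; rewrite sqrtr_ge0. Qed.

Lemma diff_expansion (F : V -> C) (p : V) : differentiable F p ->
  forall e : C, 0 < e -> exists2 d : R, 0 < d &
    forall h, `|h| < d%:C -> `|F (p + h) - F p - 'd F p h| <= e * `|h|.
Proof.
move=> dF e e0.
have /eqaddoP/(_ _ e0)/nbhs_ballP[d /= dpos rP] := diff_locally dF.
have [r r0 rE] := pos_complex dpos; move: rP; rewrite rE => rP.
exists r => // h hr; have := rP h; rewrite -ball_normE /= sub0r normrN => /(_ hr).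
by rewrite [p + h]addrC -addrA -opprD.
Qed.

(** Compactness again through [cube_bisection], with a dummy third coordinate. *)
Lemma bounded_on_square (psi : R -> R -> C) :
  (forall a b, exists d B, 0 < d /\
    forall s t, `|s - a| < d -> `|t - b| < d -> `|psi s t| <= B%:C) ->
  exists B, forall s t, 0 <= s < 1 -> 0 <= t < 1 -> `|psi s t| <= B%:C.
Proof.
move=> loc; pose P (x y z r : R) := exists B : R,
  forall s t, x <= s < x + r -> y <= t < y + r -> `|psi s t| <= B%:C.
suff : P 0 0 0 1 by rewrite /P !add0r.
apply: cube_bisection => [x y z r r0 Psub|a b c].
  have {}Psub (i j : bool) := Psub i j false.
  have [B00 h00] := Psub false false; have [B01 h01] := Psub false true.
  have [B10 h10] := Psub true false; have [B11 h11] := Psub true true.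
  exists (Num.max (Num.max B00 B01) (Num.max B10 B11)) => s t /andP[xs sx] /andP[yt ty].
  rewrite /= !mul0r !mul1r !addr0 in h00 h01 h10 h11.
  have sx' : s < x + r / 2 + r / 2 by rewrite -addrA -splitr.
  have ty' : t < y + r / 2 + r / 2 by rewrite -addrA -splitr.
  have [sm|ms] := ltP s (x + r / 2); have [tm|mt] := ltP t (y + r / 2).
  - by apply: le_trans (h00 s t _ _) _; rewrite ?xs ?sm ?yt ?tm// lecR !le_max lexx ?orbT.
  - by apply: le_trans (h01 s t _ _) _; rewrite ?xs ?sm ?mt ?ty'// lecR !le_max lexx ?orbT.
  - by apply: le_trans (h10 s t _ _) _; rewrite ?ms ?sx' ?yt ?tm// lecR !le_max lexx ?orbT.
  - by apply: le_trans (h11 s t _ _) _; rewrite ?ms ?sx' ?mt ?ty'// lecR !le_max lexx ?orbT.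
have [d [B [d0 dP]]] := loc a b; exists d => // x y z r /andP[r0 rd] xa yb _.
by exists B => s t hs ht; apply: dP; rewrite ltr_norml; apply/andP; split; lra.
Qed.

Definition tends0 (u : nat -> C) :=
  forall e : C, 0 < e -> exists N, forall n, (N <= n)%N -> `|u n| <= e.

Lemma tends0D u v : tends0 u -> tends0 v -> tends0 (fun n => u n + v n).
Proof.
move=> u0 v0 e e0; have e20 : 0 < e / 2 by rewrite divr_gt0.
have [N NP] := u0 _ e20; have [M MP] := v0 _ e20.
exists (N + M)%N => n nNM; apply: le_trans (ler_normD _ _) _.
rewrite [leRHS]splitr; apply: lerD; first by rewrite NP// (leq_trans (leq_addr M _)).
by rewrite MP// (leq_trans (leq_addl N _)).
Qed.

Lemma tends0Z (c : C) u : tends0 u -> tends0 (fun n => c * u n).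
Proof.
move=> u0 e e0; have c0 : 0 < `|c| + 1 by rewrite ltr_wpDl.
have [N NP] := u0 (e / (`|c| + 1)) (divr_gt0 e0 c0).
exists N => n /NP h; rewrite normrM.
apply: (@le_trans _ _ ((`|c| + 1) * `|u n|)).
  by rewrite ler_wpM2r// lerDl.
by rewrite mulrC -ler_pdivlMr.
Qed.

Section QuasiPeriodic.
Variables (F : V -> C) (e1 e2 f1 f2 : V) (z1 z2 : V -> C) (c1 c2 : C).
Hypothesis F_holo : holomorphic F.
Hypothesis zE : forall v, v = z1 v *: e1 + z2 v *: e2.
Hypothesis z1D : forall v a b, z1 (v + a *: e1 + b *: e2) = z1 v + a.
Hypothesis z2D : forall v a b, z2 (v + a *: e1 + b *: e2) = z2 v + b.
Hypothesis Fe1 : forall v, F (v + e1) = F v.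
Hypothesis Fe2 : forall v, F (v + e2) = F v.
Hypothesis c1_neq0 : c1 != 0.
Hypothesis c2_neq0 : c2 != 0.
Hypothesis Ff1 : forall v, F (v + f1) = c1 * cexp ((2 * pi)%:C * 'i * z1 v) * F v.
Hypothesis Ff2 : forall v, F (v + f2) = c2 * cexp ((2 * pi)%:C * 'i * z2 v) * F v.
Hypothesis F_odd : forall v, F (- v) = - F v.

Let plane (v : V) (s t : R) : V := v + s%:C *: e1 + t%:C *: e2.
Let mean n (m : R -> R -> C) (v : V) : C :=
  mu2 n (fun s t => F (plane v s t) * m s t) 0 0 1.

(** The coefficient of [u] is the differential at [w]. By C-linearity it is the combination, with
    the complex coordinates of [w], of the differentials at [e1] and [e2]: this is the relation
    required by [flux_cvg0]. *)
Lemma plane_expansion (v w : V) (a b c : R) (e : C) : 0 < e ->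
  exists (al be : C) (d : R), 0 < d /\
  forall s t u m : R, `|s - a| <= m -> `|t - b| <= m -> `|u - c| <= m -> m < d ->
  `|F (plane (v + u%:C *: w) s t) -
    (F (plane (v + c%:C *: w) a b) + (s - a)%:C * al + (t - b)%:C * be
      + (u - c)%:C * (z1 w * al + z2 w * be))| <= e * m%:C.
Proof.
move=> e0; set p := plane (v + c%:C *: w) a b.
pose K : C := 1 + `|e1| + `|e2| + `|w|.
have K0 : 0 < K by rewrite /K -!addrA ltr_pwDl// !addr_ge0.
have [k k0 kE] := pos_complex K0.
have [d d0 dP] := diff_expansion (F_holo p) (divr_gt0 e0 K0).
exists ('d F p e1), ('d F p e2), (d / k); split; first by rewrite divr_gt0.
move=> s t u m sa tb uc md.
set h := (s - a)%:C *: e1 + (t - b)%:C *: e2 + (u - c)%:C *: w.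
have m0 : 0 <= m by apply: le_trans sa.
have hm : `|h| <= K * m%:C.
  have cm (x : R) (y : V) : `|x| <= m -> `|x%:C *: y| <= `|y| * m%:C.
    move=> xm; rewrite normrZ mulrC ler_wpM2l//.
    by rewrite normc_def /= expr0n addr0 sqrtr_sqr lecR.
  apply: le_trans (ler_normD _ _) _; apply: (@le_trans _ _ ((`|e1| + `|e2| + `|w|) * m%:C)).
    rewrite 2!mulrDl; apply: lerD; last exact: cm.
    by apply: le_trans (ler_normD _ _) _; apply: lerD; apply: cm.
  by rewrite ler_wpM2r ?lecR// /K -!addrA lerDr.
have -> : plane (v + u%:C *: w) s t = p + h.
  by rewrite /p /h /plane !rmorphB /=; apply/rowP => i; rewrite !mxE; ring.
have -> : F p + (s - a)%:C * 'd F p e1 + (t - b)%:C * 'd F p e2 +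
    (u - c)%:C * (z1 w * 'd F p e1 + z2 w * 'd F p e2) = F p + 'd F p h.
  have dw : 'd F p w = z1 w * 'd F p e1 + z2 w * 'd F p e2.
    by rewrite {1}(zE w) linearD !linearZ.
  by rewrite /h !linearD !linearZ /= dw -!addrA.
rewrite opprD addrA; apply: le_trans (dP h _) _.
  by apply: le_lt_trans hm _; rewrite kE -rmorphM ltcR mulrC -ltr_pdivlMr.
rewrite mulrAC ler_pdivrMr// -mulrA ler_pM2l//.
by rewrite mulrC.
Qed.

Lemma plane_lipschitz (v : V) (a b : R) : exists K d : R, [/\ 0 < K, 0 < d &
  forall s t m : R, `|s - a| <= m -> `|t - b| <= m -> m < d ->
    `|F (plane v s t) - F (plane v a b)| <= (K * m)%:C].
Proof.
have [al [be [d [d0 dP]]]] := @plane_expansion v 0 a b 0 1 ltr01.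
have [ra ra0 raE] := norm_complex al; have [rb rb0 rbE] := norm_complex be.
exists (1 + ra + rb), d; split => // [|s t m sa tb md].
  by rewrite -addrA ltr_pwDl ?addr_ge0.
have m0 : 0 <= m by apply: le_trans sa.
have := dP s t 0 m sa tb; rewrite subrr normr0 mul0r addr0 scaler0 addr0 mul1r.
move=> /(_ m0 md); set A := F _; set B := F _ => h.
have cm (x : R) (y : C) (r : R) : `|x| <= m -> `|y| = r%:C -> `|x%:C * y| <= (r * m)%:C.
  move=> xm yr; rewrite normrM yr normc_def /= expr0n addr0 sqrtr_sqr mulrC.
  rewrite -rmorphM lecR ler_wpM2l// -lecR -yr; exact: normr_ge0.
have -> : A - B = A - (B + (s - a)%:C * al + (t - b)%:C * be)
   + ((s - a)%:C * al + (t - b)%:C * be) by ring.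
have -> : ((1 + ra + rb) * m)%:C = m%:C + ((ra * m)%:C + (rb * m)%:C).
  by rewrite -!rmorphD /=; congr (_%:C); ring.
apply: le_trans (ler_normD _ _) _; apply: lerD => //.
by apply: le_trans (ler_normD _ _) _; apply: lerD; apply: cm.
Qed.

Lemma plane_e1 v s t : F (plane v (s + 1) t) = F (plane v s t).
Proof.
rewrite -[RHS]Fe1 /plane; congr F; rewrite rmorphD /=.
by apply/rowP => i; rewrite !mxE; ring.
Qed.

Lemma plane_e2 v s t : F (plane v s (t + 1)) = F (plane v s t).
Proof.
rewrite -[RHS]Fe2 /plane; congr F; rewrite rmorphD /=.
by apply/rowP => i; rewrite !mxE; ring.
Qed.

(* The Fourier coefficient of F against m vanishes on every translate of the torus. *)
Let null (m : R -> R -> C) := forall v, tends0 (fun n => mean n m v).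

(** On the translate through 0 the sum is exactly 0 by oddness. The flux through the cube that leads
    from there to the translate by [v] tends to 0, and its lateral faces cancel by periodicity. *)
Lemma null1 : null (fun _ _ => 1).
Proof.
move=> v e e0.
have [phi phiE] : exists phi : R -> R -> R -> C, forall s t u,
    phi s t u = F (plane (0 + u%:C *: v) s t) by eexists.
have [|N NP] := @flux_cvg0 _ phi (z1 v) (z2 v) _ e e0.
  move=> a b c e' e'0; have [al [be [d [d0 dP]]]] := plane_expansion 0 v a b c e'0.
  by exists al, be, d; split=> // s t u m sa tb uc md; rewrite !phiE; apply: dP.
exists N => n /NP; rewrite flux_periodic; first last.
- by move=> s; apply/funext => u; rewrite !phiE -[1]add0r plane_e2.
- by apply/funext => t; apply/funext => u; rewrite !phiE -[1]add0r plane_e1.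
have -> : mu2 n (fun s t => phi s t 0) 0 0 1 = 0.
  apply: mu2_odd => s t; rewrite !phiE ?plane_e1 ?plane_e2//.
  rewrite -F_odd; congr F; rewrite /plane !rmorphN /=.
  by apply/rowP => i; rewrite !mxE; ring.
have <- : mean n (fun _ _ => 1) v = mu2 n (fun s t => phi s t 1) 0 0 1.
  congr mu2; apply/funext => s; apply/funext => t.
  by rewrite phiE mulr1 add0r scale1r.
by rewrite subr0.
Qed.

Lemma nullD m m' : null m -> null m' -> null (fun s t => m s t + m' s t).
Proof.
move=> m0 m'0 v; have := tends0D (m0 v) (m'0 v).
rewrite (_ : (fun n => _) = fun n => mean n (fun s t => m s t + m' s t) v) //.
apply/funext => n; rewrite /mean -mu2D; congr mu2.
by apply/funext => s; apply/funext => t; rewrite mulrDr.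
Qed.

Lemma nullZ c m : null m -> null (fun s t => c * m s t).
Proof.
move=> m0 v; have := tends0Z c (m0 v).
rewrite (_ : (fun n => _) = fun n => mean n (fun s t => c * m s t) v) //.
apply/funext => n; rewrite /mean -mu2Z; congr mu2.
by apply/funext => s; apply/funext => t; rewrite mulrCA.
Qed.

(* A translation by f changes F by a character: this shifts Fourier coefficients. *)
Lemma null_shift (f : V) (K : V -> C) (X : R -> R -> C) m :
  (forall v, K v != 0) -> (forall s t, X s t != 0) ->
  (forall v s t, F (plane (v + f) s t) = K v * X s t * F (plane v s t)) ->
  null m ->
  null (fun s t => X s t * m s t) /\ null (fun s t => (X s t)^-1 * m s t).
Proof.
move=> K0 X0 Ff m0; split=> v.
  have := tends0Z (K v)^-1 (m0 (v + f)).
  rewrite (_ : (fun n => _) = fun n => mean n (fun s t => X s t * m s t) v) //.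
  apply/funext => n; rewrite /mean -mu2Z; congr mu2.
  by apply/funext => s; apply/funext => t; rewrite Ff; field.
have := tends0Z (K (v - f)) (m0 (v - f)).
rewrite (_ : (fun n => _) = fun n => mean n (fun s t => (X s t)^-1 * m s t) v) //.
apply/funext => n; rewrite /mean -mu2Z; congr mu2.
apply/funext => s; apply/funext => t; rewrite -[in RHS](subrK f v) Ff; field.
exact: X0.
Qed.

Let X (x : R) := cexp ((2 * pi)%:C * 'i * x%:C).

Lemma kernelE s t : (kernel s t)%:C =
  2^-1 - 8^-1 * (X s + (X s)^-1 + (X t + (X t)^-1)).
Proof.
have XE (x : R) : X x = cos (2 * pi * x) +i* sin (2 * pi * x).
  by rewrite /X /cexp /=; simpc; rewrite expR0 !mul1r.
have XV (x : R) : (X x)^-1 = cos (2 * pi * x) -i* sin (2 * pi * x).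
  apply: (mulfI (cexp_neq0 ((2 * pi)%:C * 'i * x%:C))).
  rewrite mulfV ?cexp_neq0// -/(X x) XE; simpc => /=.
  apply/eqP; rewrite eq_complex /=; apply/andP; split; apply/eqP; last ring.
  by rewrite -[LHS](cos2Dsin2 (2 * pi * x)); ring.
rewrite !XV !XE /kernel.
have -> : 2^-1 = (2^-1)%:C :> C by rewrite fmorphV rmorph_nat.
have -> : 8^-1 = (8^-1)%:C :> C by rewrite fmorphV rmorph_nat.
by simpc; apply/eqP; rewrite eq_complex /=; apply/andP; split; apply/eqP; field.
Qed.

(** By [kernelE] the kernel is a combination of 1 and of the characters, with their inverses, by
    which translation by [f1] and [f2] multiplies F; each of these preserves [null]. *)
Lemma null_kernel m : null m -> null (fun s t => (kernel s t)%:C * m s t).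
Proof.
move=> m0; have X0 (x : R) : X x != 0 by apply: cexp_neq0.
have [||v s t|h1 h1'] := @null_shift f1
  (fun v => c1 * cexp ((2 * pi)%:C * 'i * z1 v)) (fun s t => X s) m _ _ _ m0.
- by move=> v; rewrite mulf_neq0// cexp_neq0.
- by move=> s t; apply: X0.
- rewrite (_ : plane (v + f1) s t = plane v s t + f1); last first.
    by rewrite /plane; apply/rowP => i; rewrite !mxE; ring.
  by rewrite Ff1 z1D mulrDr cexpD mulrA.
have [||v s t|h2 h2'] := @null_shift f2
  (fun v => c2 * cexp ((2 * pi)%:C * 'i * z2 v)) (fun s t => X t) m _ _ _ m0.
- by move=> v; rewrite mulf_neq0// cexp_neq0.
- by move=> s t; apply: X0.
- rewrite (_ : plane (v + f2) s t = plane v s t + f2); last first.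
    by rewrite /plane; apply/rowP => i; rewrite !mxE; ring.
  by rewrite Ff2 z2D mulrDr cexpD mulrA.
have := nullD (nullZ 2^-1 m0) (nullZ (- 8^-1) (nullD (nullD h1 h1') (nullD h2 h2'))).
rewrite (_ : (fun s t => _) = (fun s t => (kernel s t)%:C * m s t)) //.
by apply/funext => s; apply/funext => t; rewrite kernelE; ring.
Qed.

Lemma null_kernelX k : null (fun s t => (kernel s t ^+ k)%:C).
Proof.
elim: k => [|k /null_kernel]; first exact: null1.
rewrite (_ : (fun s t => _) = (fun s t => (kernel s t ^+ k.+1)%:C)) //.
by apply/funext => s; apply/funext => t; rewrite exprS [RHS]rmorphM.
Qed.

(* All Fourier coefficients of F on the real torus spanned by e1, e2 vanish,
   whereas (kernel ^ k) concentrates at (1/2, 1/2). *)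
Lemma quasi_periodic_odd_eq0 v : F v = 0.
Proof.
apply: contrapT => /eqP Fv0.
(* The translate on which [v] sits at the peak of the kernel. *)
pose w := v - 2^-1%:C *: e1 - 2^-1%:C *: e2.
have wv : plane w 2^-1 2^-1 = v.
  by rewrite /plane /w; apply/rowP => i; rewrite !mxE; ring.
pose psi s t := (F v)^-1 * F (plane w s t).
have [r r0 rE] := norm_complex (F v)^-1.
have [B psiB] : exists B, forall s t, 0 <= s < 1 -> 0 <= t < 1 -> `|psi s t| <= B%:C.
  apply: bounded_on_square => a b.
  have [K [d [K0 d0 dP]]] := plane_lipschitz w a b.
  have [p p0 pE] := norm_complex (F (plane w a b)).
  exists (d / 2), (r * (K * (d / 2) + p)); split; first by rewrite divr_gt0.
  move=> s t hs ht; rewrite normrM rE rmorphM.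
  have rC0 : 0 <= r%:C :> C by rewrite lecR.
  apply: (ler_wpM2l rC0).
  rewrite -[F (plane w s t)](subrK (F (plane w a b))) [X in _ <= X]rmorphD /= -pE.
  apply: le_trans (ler_normD _ _) _; apply: lerD => //.
  by apply: dP; [exact: ltW|exact: ltW|lra].
have [d d0 psi1] : exists2 d, 0 < d & forall s t, `|s - 2^-1| < d -> `|t - 2^-1| < d ->
     2^-1 <= complex.Re (psi s t).
  have [K [d [K0 d0 dP]]] := plane_lipschitz w 2^-1 2^-1.
  (* With [r] the modulus of 1 / F v, this makes [|psi - 1|] at most r K d' <= 1/2 near the peak,
     hence the real part of [psi] at least 1/2. *)
  pose d' := Num.min (d / 2) (2^-1 / ((r + 1) * K)).
  have rK0 : 0 < (r + 1) * K by rewrite mulr_gt0// ltr_wpDl.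
  exists d'; first by rewrite lt_min !divr_gt0 ?invr_gt0.
  have d'd : d' < d.
    by apply: (@le_lt_trans _ _ (d / 2)); [rewrite ge_min lexx|lra].
  have d'K : r * (K * d') <= 2^-1.
    have : d' <= 2^-1 / ((r + 1) * K) by rewrite ge_min lexx orbT.
    rewrite ler_pdivlMr// => h; apply: le_trans h.
    rewrite mulrA [leRHS]mulrC ler_wpM2r//.
      by rewrite le_min !divr_ge0 ?invr_ge0// ltW.
    by apply: ler_wpM2r; [exact: ltW|rewrite lerDl].
  move=> s t hs ht; have := dP s t d' (ltW hs) (ltW ht) d'd; rewrite wv => h.
  have : `|psi s t - 1| <= (2^-1)%:C.
    have -> : psi s t - 1 = (F v)^-1 * (F (plane w s t) - F v).
      by rewrite mulrBr mulVf.
    rewrite normrM rE; apply: (@le_trans _ _ (r%:C * (K * d')%:C)).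
      by apply: ler_wpM2l => //; rewrite lecR.
    by rewrite -rmorphM lecR.
  move=> /(le_trans (normc_ge_Re _)); rewrite lecR raddfB /= ler_norml => /andP[].
  lra.
have [k [c c0 [N NP]]] := mu2_kernel_lower_bound d0 psiB psi1.
have c20 : 0 < (c / 2)%:C :> C by rewrite ltcR divr_gt0.
have [M MP] := tends0Z (F v)^-1 (null_kernelX k w) c20.
have := NP (N + M)%N (leq_addr _ _); have := MP (N + M)%N (leq_addl _ _).
rewrite /mean -mu2Z.
rewrite (_ : (fun s t => _) = (fun s t => psi s t * (kernel s t ^+ k)%:C)); last first.
  by apply/funext => s; apply/funext => t; rewrite mulrA.
move=> /(le_trans (normc_ge_Re _)); rewrite lecR => h1 h2.
have := le_trans h2 (le_trans (ler_norm _) h1); lra.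
Qed.

End QuasiPeriodic.
End Vanishing.

(** * Evenness of sections of characteristic 0 *)

Section Polarization.
Variable R : realType.
Local Notation C := R[i].
Local Notation V := 'rV[R[i]]_2.
Variables (L : zmodClosed V) (E : V -> V -> R).
Hypothesis pol : polarization L E.

Lemma polDl (u v w : V) : E (u + v) w = E u w + E v w.
Proof. by have := pol_linl pol 1 u v w; rewrite scale1r mul1r. Qed.
Lemma polDr (u v w : V) : E w (u + v) = E w u + E w v.
Proof. by have := pol_linr pol 1 u v w; rewrite scale1r mul1r. Qed.
Lemma pol0l (w : V) : E 0 w = 0.
Proof. by apply: (addrI (E 0 w)); rewrite -polDl !addr0. Qed.
Lemma pol0r (w : V) : E w 0 = 0.
Proof. by apply: (addrI (E w 0)); rewrite -polDr !addr0. Qed.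
Lemma polZl (a : R) (u w : V) : E (a%:C *: u) w = a * E u w.
Proof. by have := pol_linl pol a u 0 w; rewrite pol0l !addr0. Qed.
Lemma polZr (a : R) (u w : V) : E w (a%:C *: u) = a * E w u.
Proof. by have := pol_linr pol a u 0 w; rewrite pol0r !addr0. Qed.
Lemma polNl (u w : V) : E (- u) w = - E u w.
Proof. by apply/eqP; rewrite -addr_eq0 -polDl addNr pol0l. Qed.
Lemma polNr (u w : V) : E w (- u) = - E w u.
Proof. by apply/eqP; rewrite -addr_eq0 -polDr addNr pol0r. Qed.
Lemma pol_anti (u v : V) : E u v = - E v u.
Proof.
apply/eqP; rewrite -addr_eq0; have := pol_alt pol (u + v).
by rewrite polDl !polDr !(pol_alt pol) add0r addr0 => ->.
Qed.
Lemma pol_isym (u v : V) : E ('i *: u) v = E ('i *: v) u.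
Proof.
rewrite -[LHS](pol_i pol) scalerA -expr2 sqr_i scaleN1r polNl.
by rewrite [RHS]pol_anti.
Qed.

Lemma hermDl (u v w : V) :
  Defs.hermitian E (u + v) w = Defs.hermitian E u w + Defs.hermitian E v w.
Proof. by rewrite /Defs.hermitian scalerDr !polDl. Qed.

Lemma hermZl (a : C) (u w : V) : Defs.hermitian E (a *: u) w = a * Defs.hermitian E u w.
Proof.
case: a => x y.
have -> : (x +i* y) *: u = x%:C *: u + y%:C *: ('i *: u).
  by rewrite scalerA -scalerDl; congr (_ *: _); rewrite [LHS]complexE mulrC.
have iZ (r : R) (t : V) : 'i *: (r%:C *: t) = r%:C *: ('i *: t).
  by rewrite !scalerA mulrC.
rewrite hermDl /Defs.hermitian !iZ !polZl scalerA -expr2 sqr_i scaleN1r polNl.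
by apply/eqP; rewrite eq_complex /=; apply/andP; split; apply/eqP; ring.
Qed.

Lemma hermNN (u v : V) : Defs.hermitian E (- u) (- v) = Defs.hermitian E u v.
Proof. by rewrite /Defs.hermitian scalerN !polNl !polNr !opprK. Qed.

Lemma herm_conj (u v : V) : Defs.hermitian E u v = Defs.hermitian E v u + 2 * 'i * (E u v)%:C.
Proof.
rewrite /Defs.hermitian pol_isym [E v u]pol_anti.
by apply/eqP; rewrite eq_complex /=; apply/andP; split; apply/eqP; ring.
Qed.

Section Decomposition.
Variables (V1 V2 : set V).
Hypotheses (sub1 : real_subspace V1) (sub2 : real_subspace V2).
Hypothesis split12 : direct_sum V1 V2.

Lemma subspaceN (W : set V) u : real_subspace W -> W u -> W (- u).
Proof.
by move=> [W0 Wlin] Wu; have := Wlin (-1) u 0 Wu W0; rewrite addr0 rmorphN scaleN1r.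
Qed.

Lemma subspaceD (W : set V) u v : real_subspace W -> W u -> W v -> W (u + v).
Proof.
by move=> [W0 Wlin] Wu Wv; have := Wlin 1 u v Wu Wv; rewrite scale1r.
Qed.

Lemma subspaceZ (W : set V) (a : R) u : real_subspace W -> W u -> W (a%:C *: u).
Proof. by move=> [W0 Wlin] Wu; rewrite -[_ *: _]addr0; exact: Wlin. Qed.

Lemma componentD u w : V1 u -> V2 w -> component V1 V2 (u + w) = u.
Proof.
move=> V1u V2w; rewrite /component; case: xgetP => [u' _ [V1u' V2u']|/(_ u)]; last first.
  by case; split=> //; rewrite addrC addKr.
have : (V1 `&` V2) (u' - u).
  split; first by apply: subspaceD => //; apply: subspaceN.
  have -> : u' - u = w - (u + w - u') by apply/rowP => i; rewrite !mxE; ring.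
  by apply: subspaceD => //; apply: subspaceN.
by rewrite split12.2 => /eqP; rewrite subr_eq0 => /eqP.
Qed.

Lemma chi0D u w : V1 u -> V2 w -> chi0 E V1 V2 (u + w) = cexp ((pi * E u w)%:C * 'i).
Proof. by move=> V1u V2w; rewrite /chi0 componentD// addrC addKr. Qed.

Lemma chi0_V1 u : V1 u -> chi0 E V1 V2 u = 1.
Proof.
move=> V1u; rewrite -[u]addr0 chi0D//; last exact: sub2.1.
by rewrite pol0r mulr0 mul0r cexp0.
Qed.

Lemma chi0_V2 u : V2 u -> chi0 E V1 V2 u = 1.
Proof.
move=> V2u; rewrite -[u]add0r chi0D//; last exact: sub1.1.
by rewrite pol0l mulr0 mul0r cexp0.
Qed.

End Decomposition.

Lemma coordinates (e1 e2 : V) :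
  (forall a b : C, a *: e1 + b *: e2 = 0 -> a = 0 /\ b = 0) ->
  exists z1 z2 : V -> C,
    [/\ forall v, v = z1 v *: e1 + z2 v *: e2,
        forall (a : C) u v, z1 (a *: u + v) = a * z1 u + z1 v,
        forall (a : C) u v, z2 (a *: u + v) = a * z2 u + z2 v,
        holomorphic z1 & holomorphic z2].
Proof.
move=> free; pose W : 'M[C]_2 := \matrix_(i, j) (if i == ord0 then e1 else e2) ord0 j.
have mulW (c : 'rV[C]_2) : c *m W = c ord0 ord0 *: e1 + c ord0 ord_max *: e2.
  apply/rowP => j; rewrite !mxE big_ord_recl big_ord1 !mxE /=.
  by rewrite (_ : lift ord0 ord0 = ord_max) //; apply/val_inj.
have Wu : W \in unitmx.
  rewrite -row_free_unit -kermx_eq0; apply/eqP/row_matrixP => i; rewrite row0.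
  have : row i (kermx W) *m W = 0 by apply/sub_kermxP; exact: row_sub.
  rewrite mulW => /free[h1 h2]; apply/rowP => j; rewrite [RHS]mxE.
  case: (unliftP ord0 j) => [k|] ->; last exact: h1.
  by rewrite -[RHS]h2; congr (_ _ _); apply/val_inj; rewrite (ord1 k).
pose z (j : 'I_2) (v : V) : C := (v *m invmx W) ord0 j.
have z_lin j (a : C) u v : z j (a *: u + v) = a * z j u + z j v.
  by rewrite /z mulmxDl -scalemxAl !mxE.
have z_holo j : holomorphic (z j).
  have -> : z j = (fun v : V => v ord0 ord0) * cst (invmx W ord0 j) +
      (fun v : V => v ord0 ord_max) * cst (invmx W ord_max j).
    apply/funext => u; rewrite /z mxE big_ord_recl big_ord1.
    by rewrite (_ : lift ord0 ord0 = ord_max) //; apply/val_inj.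
  exact: (holomorphicD (holomorphicM (holomorphic_coord _ _) (holomorphic_cst _))
    (holomorphicM (holomorphic_coord _ _) (holomorphic_cst _))).
exists (z ord0), (z ord_max); split=> // v.
by rewrite -mulW mulmxKV.
Qed.


Section SymplecticBasis.
Variables (V1 V2 : set V) (e1 e2 f1 f2 : V).
Hypotheses (sub1 : real_subspace V1) (sub2 : real_subspace V2).
Hypothesis split12 : direct_sum V1 V2.
Hypothesis iso1 : isotropic E V1.
Hypotheses (V1e1 : V1 e1) (V1e2 : V1 e2) (V2f1 : V2 f1) (V2f2 : V2 f2).
Hypotheses (Ee1f1 : E e1 f1 = 1) (Ee1f2 : E e1 f2 = 0).
Hypotheses (Ee2f1 : E e2 f1 = 0) (Ee2f2 : E e2 f2 = 1).

(* V1 is totally real: if v and i v are in V1 then E(iv, v) = 0. *)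
Lemma isotropic_free (a b : C) : a *: e1 + b *: e2 = 0 -> a = 0 /\ b = 0.
Proof.
case: a b => [a a'] [b b'] ab0.
pose u := a%:C *: e1 + b%:C *: e2; pose w := a'%:C *: e1 + b'%:C *: e2.
have V1u : V1 u by apply: sub1.2 => //; exact: subspaceZ.
have V1w : V1 w by apply: sub1.2 => //; exact: subspaceZ.
have uw : u = - ('i *: w).
  apply/eqP; rewrite -addr_eq0 -ab0 /u /w scalerDr !scalerA [a +i* a']complexE.
  by rewrite [b +i* b']complexE /= !scalerDl addrACA.
have w0 : w = 0.
  apply: contrapT => /eqP/(pol_pos pol).
  by rewrite -[_ *: _]opprK -uw polNl iso1 // oppr0 ltxx.
have u0 : u = 0 by rewrite uw w0 scaler0 oppr0.
have coef x y : x%:C *: e1 + y%:C *: e2 = 0 -> x = 0 /\ y = 0.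
  move=> xy0; split.
    by have := pol0l f1; rewrite -xy0 polDl !polZl Ee1f1 Ee2f1 mulr0 addr0 mulr1.
  by have := pol0l f2; rewrite -xy0 polDl !polZl Ee1f2 Ee2f2 mulr0 add0r mulr1.
by have [-> ->] := coef _ _ u0; have [-> ->] := coef _ _ w0.
Qed.

(** Positivity replaces a dimension count for [V1]. Over C the vectors e1, e2 span; removing the
    real parts of the coordinates of [u] leaves i q with both q and i q in [V1], so E(iq, q) = 0 and
    q = 0. *)
Lemma isotropic_expansion u : V1 u -> u = (E u f1)%:C *: e1 + (E u f2)%:C *: e2.
Proof.
move=> V1u; have [z1 [z2 [zE _ _ _ _]]] := coordinates isotropic_free.
pose p := u - (complex.Re (z1 u))%:C *: e1 - (complex.Re (z2 u))%:C *: e2.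
pose q := (complex.Im (z1 u))%:C *: e1 + (complex.Im (z2 u))%:C *: e2.
have V1q : V1 q by apply: subspaceD => //; apply: subspaceZ.
have V1p : V1 p.
  by apply: subspaceD => //; [apply: subspaceD => //|]; apply: subspaceN => //; apply: subspaceZ.
have pq : p = 'i *: q.
  have im (z : C) : 'i * (complex.Im z)%:C = z - (complex.Re z)%:C.
    by rewrite {2}(complexE z) addrAC subrr add0r.
  rewrite /p {1}(zE u) /q scalerDr !scalerA !im.
  by apply/rowP => j; rewrite !mxE; ring.
have q0 : q = 0.
  by apply: contrapT => /eqP/(pol_pos pol); rewrite -pq iso1// ltxx.
have [a [b ->]] : exists a b : R, u = a%:C *: e1 + b%:C *: e2.
  exists (complex.Re (z1 u)), (complex.Re (z2 u)).
  by apply/eqP; rewrite -subr_eq0 opprD addrA -/p pq q0 scaler0.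
rewrite !polDl !polZl Ee1f1 Ee1f2 Ee2f1 Ee2f2.
by rewrite !mulr0 !mulr1 addr0 add0r.
Qed.

Lemma odd_section_eq0 (g : V -> C) : holomorphic g ->
  (forall v, g (- v) = - g v) ->
  (forall l v, l \in [:: e1; e2; f1; f2] ->
    g (v + l) = cexp (pi%:C * Defs.hermitian E v l
                      + (pi / 2)%:C * Defs.hermitian E l l) * g v) ->
  forall v, g v = 0.
Proof.
move=> g_holo g_odd gE.
have [z1 [z2 [zE z1lin z2lin z1_holo z2_holo]]] := coordinates isotropic_free.
have z1D u v : z1 (u + v) = z1 u + z1 v.
  by have := z1lin 1 u v; rewrite scale1r mul1r.
have z2D u v : z2 (u + v) = z2 u + z2 v.
  by have := z2lin 1 u v; rewrite scale1r mul1r.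
have zu a b : z1 (a *: e1 + b *: e2) = a /\ z2 (a *: e1 + b *: e2) = b.
  set v := _ + _; have : (z1 v - a) *: e1 + (z2 v - b) *: e2 = 0.
    rewrite !scalerBl addrACA -zE -opprD; exact: subrr.
  by move=> /isotropic_free[/eqP + /eqP]; rewrite !subr_eq0 => /eqP -> /eqP ->.
have z1e1 : z1 e1 = 1 by have := (zu 1 0).1; rewrite scale1r scale0r addr0.
have z2e1 : z2 e1 = 0 by have := (zu 1 0).2; rewrite scale1r scale0r addr0.
have z1e2 : z1 e2 = 0 by have := (zu 0 1).1; rewrite scale1r scale0r add0r.
have z2e2 : z2 e2 = 1 by have := (zu 0 1).2; rewrite scale1r scale0r add0r.
pose H := Defs.hermitian E.
have HE u v : H u v = z1 u * H e1 v + z2 u * H e2 v.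
  by rewrite {1}(zE u) /H hermDl !hermZl.
have H21 : H e2 e1 = H e1 e2.
  by rewrite /H (herm_conj e2) iso1 // mulr0 addr0.
(* The C-bilinear extension of the restriction of H to V1. *)
pose B u v := z1 u * (z1 v * H e1 e1 + z2 v * H e1 e2)
            + z2 u * (z1 v * H e1 e2 + z2 v * H e2 e2).
have Be1 v : B v e1 = H v e1.
    by rewrite /B z1e1 z2e1 !mul1r !mul0r !addr0 [RHS]HE H21.
have Be2 v : B v e2 = H v e2.
  by rewrite /B z1e2 z2e2 !mul1r !mul0r !add0r [RHS]HE.
have HBf (f : V) v : B v f = H v f
   - 2 * 'i * (z1 v * (E e1 f)%:C + z2 v * (E e2 f)%:C).
  have Hf1 : H e1 f = z1 f * H e1 e1 + z2 f * H e1 e2 + 2 * 'i * (E e1 f)%:C.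
    by rewrite /H herm_conj -/H HE H21.
  have Hf2 : H e2 f = z1 f * H e1 e2 + z2 f * H e2 e2 + 2 * 'i * (E e2 f)%:C.
    by rewrite /H herm_conj -/H HE.
  by rewrite [H v f]HE Hf1 Hf2 /B; ring.
(* The passage from canonical to classical theta functions: this quadratic exponential makes the
   factors for e1, e2 trivial, and those for f1, f2 become constants times exp(2 pi i z1) and exp(2
   pi i z2). *)
pose F v := cexp (- (pi / 2)%:C * B v v) * g v.
have F_mul l v c : g (v + l) = c * g v ->
  F (v + l) = cexp (- (pi / 2)%:C * (2 * B v l + B l l)) * c * F v.
  move=> gl; rewrite /F gl.
  have -> : - (pi / 2)%:C * B (v + l) (v + l) =
     - (pi / 2)%:C * (2 * B v l + B l l) + - (pi / 2)%:C * B v v.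
    by rewrite /B !z1D !z2D; ring.
  by rewrite cexpD; ring.
have pi2 : pi%:C = 2 * (pi / 2)%:C :> C.
  have -> : (2 : C) = 2%:C by rewrite rmorph_nat.
  by rewrite -rmorphM; congr (_%:C); field.
have F_mulE l v : l \in [:: e1; e2; f1; f2] ->
  F (v + l) = cexp (pi%:C * (H v l - B v l) + (pi / 2)%:C * (H l l - B l l)) * F v.
  by move=> /gE/F_mul ->; congr (_ * _); rewrite -cexpD -/H; congr cexp; rewrite pi2; ring.
have Q_holo : holomorphic (fun v => - (pi / 2)%:C * B v v).
  have -> : (fun v => - (pi / 2)%:C * B v v) = (cst (- (pi / 2)%:C) *
      (z1 * (z1 * cst (H e1 e1) + z2 * cst (H e1 e2)) +
       z2 * (z1 * cst (H e1 e2) + z2 * cst (H e2 e2))) : V -> C).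
    by apply/funext => v.
  have dL (c c' : C) : holomorphic (z1 * cst c + z2 * cst c').
    exact: (holomorphicD (holomorphicM z1_holo (holomorphic_cst c))
      (holomorphicM z2_holo (holomorphic_cst c'))).
  exact: (holomorphicM (holomorphic_cst _) (holomorphicD
    (holomorphicM z1_holo (dL _ _)) (holomorphicM z2_holo (dL _ _)))).
have F_holo : holomorphic F by exact: (holomorphicM (holomorphic_cexp Q_holo) g_holo).
have Fe1 v : F (v + e1) = F v.
  by rewrite F_mulE ?inE ?eqxx ?orbT// !Be1 !subrr !mulr0 addr0 cexp0 mul1r.
have Fe2 v : F (v + e2) = F v.
  by rewrite F_mulE ?inE ?eqxx ?orbT// !Be2 !subrr !mulr0 addr0 cexp0 mul1r.
have two_pi : (2 * pi)%:C = 2 * pi%:C :> C by rewrite rmorphM rmorph_nat.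
have Ff1 v : F (v + f1) = cexp (pi%:C * 'i * z1 f1) * cexp ((2 * pi)%:C * 'i * z1 v) * F v.
  rewrite F_mulE ?inE ?eqxx ?orbT// !HBf Ee1f1 Ee2f1 -cexpD.
  by congr (cexp _ * _); rewrite two_pi rmorph1 rmorph0 pi2; ring.
have Ff2 v : F (v + f2) = cexp (pi%:C * 'i * z2 f2) * cexp ((2 * pi)%:C * 'i * z2 v) * F v.
  rewrite F_mulE ?inE ?eqxx ?orbT// !HBf Ee1f2 Ee2f2 -cexpD.
  by congr (cexp _ * _); rewrite two_pi rmorph1 rmorph0 pi2; ring.
have z0 : z1 0 = 0 /\ z2 0 = 0.
  by have := zu 0 0; rewrite !scale0r addr0.
have F_odd v : F (- v) = - F v.
  have zN : z1 (- v) = - z1 v /\ z2 (- v) = - z2 v.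
    by split; apply/eqP; rewrite -addr_eq0 -?z1D -?z2D addNr ?z0.1 ?z0.2.
  by rewrite /F g_odd mulrN /B zN.1 zN.2; congr (- (cexp _ * _)); ring.
have z1E v a b : z1 (v + a *: e1 + b *: e2) = z1 v + a.
  by rewrite -addrA z1D (zu a b).1.
have z2E v a b : z2 (v + a *: e1 + b *: e2) = z2 v + b.
  by rewrite -addrA z2D (zu a b).2.
have F0 := quasi_periodic_odd_eq0 F_holo zE z1E z2E Fe1 Fe2
  (cexp_neq0 _) (cexp_neq0 _) Ff1 Ff2 F_odd.
move=> v; have /eqP := F0 v; rewrite /F mulf_eq0 (negbTE (cexp_neq0 _)) /=.
by move=> /eqP.
Qed.

(** Each of the four vectors lies in [V1] or [V2], so [chi0] is 1 at it and at its opposite. Hence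
    theta(-v) obeys the same four functional equations as theta(v), and so does their difference. *)
Lemma section_even (M : zmodClosed V) (theta : V -> C) :
  e1 \in M -> e2 \in M -> f1 \in M -> f2 \in M ->
  is_section M (char0_bundle E V1 V2) theta -> forall v, theta (- v) = theta v.
Proof.
move=> Me1 Me2 Mf1 Mf2 [theta_holo thetaE] v.
apply/eqP; rewrite eq_sym -subr_eq0; apply/eqP; move: v.
apply: odd_section_eq0 => [v|v|l v lb].
- by apply: differentiableB; [exact: theta_holo|exact: holomorphic_opp].
- by rewrite opprK opprB.
have [Ml chil chiNl] : [/\ l \in M, chi0 E V1 V2 l = 1 & chi0 E V1 V2 (- l) = 1].
  have c1 u : V1 u -> chi0 E V1 V2 u = 1 by apply: chi0_V1.
  have c2 u : V2 u -> chi0 E V1 V2 u = 1 by apply: chi0_V2.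
  have n1 u : V1 u -> V1 (- u) by apply: subspaceN.
  have n2 u : V2 u -> V2 (- u) by apply: subspaceN.
  by move: lb; rewrite !inE => /or4P[] /eqP ->; split; auto.
rewrite opprD !thetaE// ?rpredN// /char0_bundle /appell_humbert chil chiNl !mul1r.
by rewrite !hermNN mulrBr.
Qed.

End SymplecticBasis.

End Polarization.

(** * Symplectic bases *)

Section Integrality.
Variable R : realType.
Local Notation C := R[i].
Local Notation V := 'rV[R[i]]_2.

(** The fractional part f of |x|, or 1 - f when f > 1/2, is brought into [0, 1/2], where the angle
    stays in the range on which cos is injective. *)
Lemma cos2pi_int (x : R) : cos (2 * pi * x) = 1 -> x \is a Num.int.
Proof.
move=> cx; have p0 := @pi_gt0 R.
set n := Num.trunc `|x|; have /andP[nx xn] := truncn_itv (normr_ge0 x).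
rewrite -/n in nx xn; set f := `|x| - n%:R.
have f01 : 0 <= f < 1 by rewrite -natr1 in xn; apply/andP; split; rewrite /f; lra.
have cf : cos (2 * pi * f) = 1.
  rewrite -[RHS]cx -[RHS]cos_norm normrM ger0_norm ?mulr_ge0 ?(ltW p0)//.
  rewrite -(periodicn (@cosD2pi R) n); congr cos; rewrite /f.
  rewrite -mulr_natl -[pi *+ 2]mulr_natl; ring.
have zpi : 0 \in `[0, pi : R] by rewrite in_itv /= lexx ltW.
have cos_eq1 (u : R) : 0 <= u <= 2^-1 -> cos (2 * pi * u) = 1 -> u = 0.
  move=> hu; rewrite -[RHS](@cos0 R) => /cos_inj.
  have upi : 2 * pi * u \in `[0, pi : R].
    case/andP: hu => u0 u1; rewrite in_itv /=; apply/andP; split.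
      by rewrite !mulr_ge0// ltW.
    have : pi * u <= pi * 2^-1 :> R by rewrite ler_wpM2l // ltW.
    by have := p0; lra.
  move=> /(_ upi zpi)/eqP; rewrite !mulf_eq0 pnatr_eq0 (gt_eqF p0) /= => /eqP ->.
  by [].
have f0 : f = 0.
  have [f2|f2] := leP f 2^-1.
    by apply: cos_eq1 => //; case/andP: f01 => -> _.
  have : 1 - f = 0.
    apply: cos_eq1; first by case/andP: f01 => *; apply/andP; split; lra.
    rewrite -[RHS]cf -[RHS]cosN -[RHS](@cosD2pi R); congr cos.
    by rewrite -[pi *+ 2]mulr_natl; ring.
  by case/andP: f01; lra.
have xE : `|x| = n%:R by apply/eqP; rewrite -subr_eq0 -/f f0.
case: (ger0P x) xE => _ xE; first by rewrite xE natr_int.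
by rewrite -[x]opprK xE rpredN natr_int.
Qed.

Lemma cexp2pi_int (x : R) : cexp ((2 * pi * x)%:C * 'i) = 1 -> x \is a Num.int.
Proof.
move=> /(congr1 (@complex.Re R)); rewrite /cexp /=.
rewrite !(mulr0, mul0r, mulr1, addr0, add0r, subr0, oppr0).
rewrite expR0 mul1r; exact: cos2pi_int.
Qed.

(* The cocycle condition, read off where theta does not vanish, gives
   exp(2 pi i E(l, m)) = 1. *)
Lemma section_integral (L M : zmodClosed V) (E : V -> V -> R) (V1 V2 : set V)
    (theta : V -> C) : polarization L E ->
  is_section M (char0_bundle E V1 V2) theta -> (exists v, theta v != 0) ->
  forall l m, l \in M -> m \in M -> E l m \is a Num.int.
Proof.
move=> pol [_ thetaE] [v v0] l m Ml Mm.
have : theta (v + l + m) = theta (v + m + l) by rewrite addrAC.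
have drop (a b a' b' t : C) : t != 0 -> a * (b * t) = a' * (b' * t) -> a * b = a' * b'.
  by move=> t0; rewrite !mulrA => /(mulIf t0).
rewrite !thetaE// => /(drop _ _ _ _ _ v0).
rewrite /char0_bundle /appell_humbert !(hermDl pol).
set cl := chi0 _ _ _ l; set cm := chi0 _ _ _ m.
set H := Defs.hermitian E => h.
have cl0 : cl != 0 by apply: cexp_neq0.
have cm0 : cm != 0 by apply: cexp_neq0.
(* Both orders of translation share all factors except exp(pi H(l, m)) and exp(pi H(m, l)), which
   must therefore agree. *)
have cancel a b c k x y : cm * cexp (pi%:C * (a + x) + b) * (cl * cexp (pi%:C * c + k))
    = cl * cexp (pi%:C * (c + y) + k) * (cm * cexp (pi%:C * a + b)) ->
    cexp (pi%:C * x) = cexp (pi%:C * y).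
  have sep p q r : cexp (pi%:C * (p + q) + r) = cexp (pi%:C * q) * cexp (pi%:C * p + r).
    by rewrite -cexpD; congr cexp; ring.
  rewrite !sep; set A := cexp (_ + b); set B := cexp (_ + k) => eqAB.
  have K0 : cm * cl * (A * B) != 0 :=
    mulf_neq0 (mulf_neq0 cm0 cl0) (mulf_neq0 (cexp_neq0 _) (cexp_neq0 _)).
  by apply: (mulfI K0); transitivity (cm * (cexp (pi%:C * x) * A) * (cl * B));
    [ring|rewrite eqAB; ring].
move/cancel: h => h2; apply: cexp2pi_int.
have -> : (2 * pi * E l m)%:C * 'i = pi%:C * (H l m) - pi%:C * H m l.
  rewrite /H (herm_conj pol l) -/H.
  have -> : (2 * pi * E l m)%:C = 2 * pi%:C * (E l m)%:C :> C.
    by rewrite !rmorphM rmorph_nat.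
  by ring.
by apply: (mulIf (cexp_neq0 (pi%:C * H m l))); rewrite -cexpD subrK mul1r.
Qed.

End Integrality.

(** * First elementary divisor of an integral pairing *)

Section MinimalPair.
Variable R : realType.
Local Notation V := 'rV[R[i]]_2.
Variables (L : zmodClosed V) (E : V -> V -> R).
Hypothesis pol : polarization L E.

Lemma mulrz_scaleC (u : V) (k : int) : u *~ k = (k%:~R)%:C *: u.
Proof. by rewrite -scaler_int rmorph_int. Qed.

Lemma polMzl (u w : V) (k : int) : E (u *~ k) w = k%:~R * E u w.
Proof. by rewrite mulrz_scaleC (polZl pol). Qed.

Lemma polMzr (u w : V) (k : int) : E w (u *~ k) = k%:~R * E w u.
Proof. by rewrite mulrz_scaleC (polZr pol). Qed.

(** The least positive value g of the pairing divides all values: division with remainder, carried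
    out inside [P1] and [P2], would otherwise produce a smaller one. *)
Lemma minimal_pair (P1 P2 : set V) :
  (forall u v (k : int), P1 u -> P1 v -> P1 (u + v *~ k)) ->
  (forall u v (k : int), P2 u -> P2 v -> P2 (u + v *~ k)) ->
  (forall u w, P1 u -> P2 w -> E u w \is a Num.int) ->
  (exists u w, [/\ P1 u, P2 w & E u w != 0]) ->
  exists e f (g : nat), [/\ P1 e, P2 f, (0 < g)%N, E e f = g%:R &
    forall u w, P1 u -> P2 w -> exists k : int, E u w = k%:~R * g%:R].
Proof.
move=> P1D P2D Eint [u0 [w0 [P1u0 P2w0 E0]]].
pose Q n := `[< (0 < n)%N /\ exists u w, [/\ P1 u, P2 w & E u w = n%:R] >].
have exQ : exists n, Q n.
  have /intrP[m mE] := Eint _ _ P1u0 P2w0.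
  exists `|m|%N; apply/asboolP; split.
    by rewrite absz_gt0; apply: contraNneq E0 => m0; rewrite mE m0.
  have [m0|m0] := leP 0 m; first by exists u0, w0; split=> //; rewrite mE pmulrn gez0_abs.
  (* This is - u0, written in the only form the closure hypothesis allows. *)
  exists (u0 + u0 *~ (-2)), w0; split=> //; first exact: P1D.
  by rewrite (polDl pol) polMzl mE [RHS]pmulrn ltz0_abs// !rmorphN /=; ring.
have [g /asboolP[g0 [e [f [P1e P2f Eef]]]] gmin] := ex_minnP exQ.
have rem0 u w (r : int) : P1 u -> P2 w -> E u w = r%:~R -> (0 <= r < g)%R -> r = 0.
  move=> P1u P2w Er /andP[r0 rg]; case: r r0 rg Er => // n _ ng Er.
  have [->//|n0] := posnP n.
  have := gmin n; rewrite leqNgt -ltz_nat ng => /(_ _)/negP h.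
  by exfalso; apply: h => //; apply/asboolP; split=> //; exists u, w.
have g0z : (g : int) != 0 by rewrite -lt0n in g0 *.
have reduce u w (m : int) u' w' : P1 u -> P2 w -> E u w = m%:~R ->
    P1 u' -> P2 w' -> E u' w' = (m %% g)%Z%:~R -> exists k : int, m = k * g.
  move=> _ _ _ P1u' P2w' Er; exists (m %/ g)%Z.
  have r0 := rem0 _ _ _ P1u' P2w' Er.
  by rewrite {1}(divz_eq m g) r0 ?addr0// modz_ge0//= ltz_pmod.
have modE (m : int) : ((m %% g)%Z%:~R : R) = m%:~R + (- (m %/ g)%Z)%:~R * g%:R.
  have -> : (m %% g)%Z = m + - (m %/ g)%Z * g.
    by rewrite {2}(divz_eq m g) mulNr addrAC subrr add0r.
  by rewrite intrD intrM.
have left u : P1 u -> exists k : int, E u f = k%:~R * g%:R.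
  move=> P1u; have /intrP[m mE] := Eint _ _ P1u P2f.
  have [||k kE] := @reduce u f m (u + e *~ - (m %/ g)%Z) f P1u P2f mE _ P2f.
  - exact: P1D.
  - by rewrite (polDl pol) polMzl mE Eef modE.
  by exists k; rewrite mE kE intrM.
have right w : P2 w -> exists k : int, E e w = k%:~R * g%:R.
  move=> P2w; have /intrP[m mE] := Eint _ _ P1e P2w.
  have [||k kE] := @reduce e w m e (w + f *~ - (m %/ g)%Z) P1e P2w mE P1e _.
  - exact: P2D.
  - by rewrite (polDr pol) polMzr mE Eef modE.
  by exists k; rewrite mE kE intrM.
exists e, f, g; split=> // u w P1u P2w.
have [a aE] := left u P1u; have [b bE] := right w P2w.
have /intrP[m mE] := Eint _ _ P1u P2w.
pose n := m - a * b * g.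
(* The multiple 1 - a makes the new first vector pair with f to exactly g; adding multiples of f to
   w then moves the value by multiples of g, down to the remainder. *)
have nE : E (u + e *~ (1 - a)) (w + f *~ (- b - (n %/ g)%Z)) = (n %% g)%Z%:~R.
  rewrite !(polDl pol) !(polDr pol) !(polMzl, polMzr) aE bE mE Eef modE /n.
  by rewrite !(intrB, intrD, mulrNz, intrM); ring.
exists (a * b + (n %/ g)%Z).
have n0 : (n %% g)%Z = 0.
  by apply: (rem0 _ _ _ _ _ nE); [exact: P1D|exact: P2D|rewrite modz_ge0//= ltz_pmod].
have : m = (a * b + (n %/ g)%Z) * g.
  by rewrite mulrDl -[X in _ = _ + X]addr0 -n0 -divz_eq /n addrC subrK.
by rewrite mE => {1}->; rewrite intrM.
Qed.

End MinimalPair.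

(** * Coset representatives of a sublattice of Z^n *)

Section Cosets.

(** Smith normal form reduces to a diagonal matrix, where vectors of residues modulo the diagonal
    entries represent all cosets; the unimodular factors preserve |det P|. *)
Lemma card_cosets_le n (P : 'M[int]_n) : \det P != 0 ->
  exists (T : finType) (r : T -> 'rV[int]_n), #|T| = `|\det P|%N /\
    forall c, exists t q, c = r t + q *m P.
Proof.
move=> P0; have [U Uu [W Wu [D _ PE]]] := int_Smith_normal_form P.
set DM := (\matrix_(i, j) _) in PE.
have DMd : DM = diag_mx (\row_i D`_i).
  by apply/matrixP => i j; rewrite !mxE.
have unit_det (A : 'M[int]_n) : A \in unitmx -> `|\det A|%N = 1%N.
  by rewrite unitmxE => /orP[] /eqP ->.
pose m (i : 'I_n) : int := D`_i.
have detP : `|\det P|%N = (\prod_(i < n) `|m i|)%N.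
  rewrite PE !det_mulmx !abszM (unit_det U)// (unit_det W)// mul1n muln1.
  rewrite DMd det_diag (big_morph absz abszM (absz1 : `|1 : int|%N = 1%N)).
  by apply: eq_bigr => i _; rewrite mxE.
have D0 (i : 'I_n) : (0 < `|m i|)%N.
  rewrite lt0n; apply: contra_neq P0 => Di; apply/eqP.
  by rewrite -absz_eq0 detP (bigD1 i)//= Di mul0n.
pose T := {dffun forall i : 'I_n, 'I_(`|m i|)}.
exists T, (fun t : T => (\row_i (t i : nat)%:Z) *m W); split.
  rewrite detP card_dep_ffun.
  rewrite foldrE big_map big_enum /=; apply: eq_bigr => i _; exact: card_ord.
move=> c; have [c' c'E] : exists c', c' = c *m invmx W by eexists.
have lt_mod (i : 'I_n) : (`|(c' ord0 i %% m i)%Z| < `|m i|)%N.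
  have Di : m i != 0 by rewrite -absz_gt0.
  by rewrite -ltz_nat gez0_abs ?modz_ge0// abszE ltz_mod.
exists [ffun i => Ordinal (lt_mod i)], ((\row_i (c' ord0 i %/ m i)%Z) *m invmx U).
rewrite PE -!mulmxA mulKmx// mulmxA -mulmxDl.
apply: (can_inj (mulmxK (_ : invmx W \in unitmx))); first by rewrite unitmx_inv.
rewrite mulmxK// -c'E DMd mul_mx_diag; apply/rowP => i; rewrite !mxE ffunE.
by rewrite /= gez0_abs ?modz_ge0 -?absz_gt0// addrC -divz_eq.
Qed.

End Cosets.

(** * A symplectic basis of the overlattice adapted to the decomposition *)

Section SymplecticLattice.
Variable R : realType.
Local Notation C := R[i].
Local Notation V := 'rV[R[i]]_2.

(** Multiplication by the standard symplectic matrix makes G block diagonal, with blocks -D and -D.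
    The same matrix enters for both lattices, so its determinant cancels when they are compared. *)
Lemma det_gram (F : comUnitRingType) (G : 'M[F]_(2 + 2)) (g : F) :
  (forall i j : 'I_2, [/\ G (lshift 2 i) (lshift 2 j) = 0,
    G (rshift 2 i) (rshift 2 j) = 0 &
    G (lshift 2 i) (rshift 2 j) = (if i == ord0 then 1 else g) *+ (i == j)]) ->
  (forall i j, G j i = - G i j) ->
  \det G * \det (block_mx 0 1%:M (- 1%:M) 0 : 'M[F]_(2 + 2)) = g ^+ 2.
Proof.
move=> GE Ganti; pose D : 'M[F]_2 := diag_mx (\row_i (if i == ord0 then 1 else g)).
have -> : G = block_mx 0 D (- D) 0.
  rewrite -[G]submxK; congr block_mx; apply/matrixP => i j; rewrite !mxE.
  - by case: (GE i j).
  - by case: (GE i j).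
  - rewrite Ganti; case: (GE j i) => _ _ ->.
    by rewrite [j == i]eq_sym; case: (eqVneq i j) => [->|].
  - by case: (GE i j).
rewrite -det_mulmx mulmx_block !mulmx0 !mul0mx !addr0 add0r mulmxN !mulmx1.
rewrite det_ublock -scaleN1r detZ sqrrN expr1n mul1r.
by rewrite det_diag big_ord_recl big_ord1 !mxE /= mul1r expr2.
Qed.

Variables (d : nat) (L M : zmodClosed V) (E : V -> V -> R) (V1 V2 : set V).
Hypothesis d_gt0 : (0 < d)%N.
Hypothesis polL : polarization_type_1 d L E.
Let pol := polL.1.
Hypotheses (sub1 : real_subspace V1) (sub2 : real_subspace V2).
Hypotheses (iso1 : isotropic E V1) (iso2 : isotropic E V2).
Hypothesis splitM : lattice_split M V1 V2.
Hypothesis Eint : forall l m, l \in M -> m \in M -> E l m \is a Num.int.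
Hypothesis subLM : forall v, v \in L -> v \in M.

Let P1 : set V := [set u | V1 u /\ u \in M].
Let P2 : set V := [set u | V2 u /\ u \in M].

Lemma subgroup_step (W : set V) (f : V -> R) :
  real_subspace W -> (forall u v, f (u + v) = f u + f v) ->
  (forall u (k : int), f (u *~ k) = k%:~R * f u) ->
  forall u v (k : int), (W u /\ u \in M) /\ f u = 0 -> (W v /\ v \in M) /\ f v = 0 ->
  (W (u + v *~ k) /\ u + v *~ k \in M) /\ f (u + v *~ k) = 0.
Proof.
move=> [W0 Wlin] fD fM u v k [[Wu Mu] fu] [[Wv Mv] fv]; split; last first.
  by rewrite fD fM fu fv mulr0 addr0.
split; last by rewrite rpredD// rpredMz.
by rewrite addrC mulrz_scaleC; apply: Wlin.
Qed.

(** As V1 and V2 are isotropic, E on M is governed by the pairing of M in V1 with M in V2. A minimal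
    pair e1, f1 is split off, then a minimal pair in the orthogonal complements [Q1], [Q2]. *)
Lemma elementary_divisors : exists (e1 e2 f1 f2 : V) (g : nat),
  [/\ [/\ P1 e1, P1 e2, P2 f1 & P2 f2], (0 < g)%N,
      [/\ E e1 f1 = 1, E e1 f2 = 0, E e2 f1 = 0 & E e2 f2 = g%:R],
      forall u, P1 u -> exists k : int, E u f2 = k%:~R * g%:R &
      forall w, P2 w -> exists k : int, E e2 w = k%:~R * g%:R].
Proof.
have [_ [b [[_ bL] bE]]] := polL.
have bM i : b i \in M.
  apply: subLM; apply/bL; exists (fun j => (j == i)%:Z); rewrite (bigD1 i)//= eqxx.
  by rewrite big1 ?addr0// => j /negbTE ->.
have P1int u w : P1 u -> P2 w -> E u w \is a Num.int.
  by move=> [_ Mu] [_ Mw]; apply: Eint.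
have zP (W : set V) u v (k : int) : real_subspace W ->
    W u /\ u \in M -> W v /\ v \in M -> W (u + v *~ k) /\ u + v *~ k \in M.
  move=> Wsub Wu Wv.
  have [] := @subgroup_step W (fun=> 0) Wsub _ _ u v k (conj Wu erefl) (conj Wv erefl).
  - by move=> *; rewrite addr0.
  - by move=> *; rewrite mulr0.
  by [].
have Esplit v v' : v \in M -> v' \in M -> exists p q p' q',
   [/\ P1 p, P2 q, P1 p' & P2 q'] /\
   [/\ v = p + q, v' = p' + q' & E v v' = E p q' - E p' q].
  move=> /splitM[p [q [P1p P2q vE]]] /splitM[p' [q' [P1p' P2q' vE']]].
  exists p, q, p', q'; split=> //; split=> //.
  rewrite vE vE' (polDl pol) !(polDr pol) (iso1 P1p.1 P1p'.1) (iso2 P2q.1 P2q'.1).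
  by rewrite add0r addr0 (pol_anti pol q).
have bE02 : E (b (lshift 2 ord0)) (b (rshift 2 ord0)) = 1.
  by have [_ _ ->] := bE ord0 ord0.
have [||||e1 [f1 [g1 [P1e1 P2f1 g10 Ee1f1 g1P]]]] := @minimal_pair R L E pol P1 P2.
- by move=> u v k; apply: zP.
- by move=> u v k; apply: zP.
- exact: P1int.
- have [p [q [p' [q' [[P1p P2q P1p' P2q'] [_ _ E1]]]]]] :=
    Esplit _ _ (bM (lshift 2 ord0)) (bM (rshift 2 ord0)).
  have [Epq|Epq] := eqVneq (E p q') 0; last by exists p, q'.
  exists p', q; split=> //; apply: contra_eq_neq E1 => ->.
  by rewrite Epq subr0 bE02 oner_eq0.
(* The value 1 that E takes on two basis vectors of L is a difference of two multiples of [g1]. *)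
have g11 : g1 = 1%N.
  have [p [q [p' [q' [[P1p P2q P1p' P2q'] [_ _]]]]]] :=
    Esplit _ _ (bM (lshift 2 ord0)) (bM (rshift 2 ord0)).
  have [k ->] := g1P _ _ P1p P2q'; have [k' ->] := g1P _ _ P1p' P2q.
  rewrite bE02 -mulrBl -intrB => /eqP.
  have -> : (g1%:R : R) = (g1 : int)%:~R by [].
  rewrite -intrM -[1]/(1%:~R) eqr_int => /eqP k1.
  have : (g1 %| 1)%Z by apply/dvdzP; exists (k - k').
  by rewrite dvdz1 => /eqP.
rewrite g11 in Ee1f1 g1P.
pose Q1 : set V := [set u | P1 u /\ E u f1 = 0].
pose Q2 : set V := [set w | P2 w /\ E e1 w = 0].
have projQ1 p : P1 p -> exists2 p0, Q1 p0 & p = p0 + (E p f1)%:C *: e1.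
  move=> P1p; have /intrP[k kE] := P1int _ _ P1p P2f1.
  exists (p + e1 *~ (- k)).
    split; first exact: zP.
    by rewrite (polDl pol) (polMzl pol) kE Ee1f1 mulr1 mulrNz subrr.
  by rewrite kE -mulrz_scaleC mulrNz subrK.
have projQ2 q : P2 q -> exists2 q0, Q2 q0 & q = q0 + (E e1 q)%:C *: f1.
  move=> P2q; have /intrP[k kE] := P1int _ _ P1e1 P2q.
  exists (q + f1 *~ (- k)).
    split; first exact: zP.
    by rewrite (polDr pol) (polMzr pol) kE Ee1f1 mulr1 mulrNz subrr.
  by rewrite kE -mulrz_scaleC mulrNz subrK.
have [||||e2 [f2 [g [[P1e2 Ee2f1] [P2f2 Ee1f2] g0 Ee2f2 gP]]]] :=
  @minimal_pair R L E pol Q1 Q2.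
- apply: subgroup_step => // *; [exact: (polDl pol)|exact: (polMzl pol)].
- apply: subgroup_step => // *; [exact: (polDr pol)|exact: (polMzr pol)].
- by move=> u w [P1u _] [P2w _]; apply: P1int.
- (* Otherwise E would have rank 2, and the Plucker relation for the b i fails. *)
  apply: contrapT => nQ.
  have EQ0 u w : Q1 u -> Q2 w -> E u w = 0.
    by move=> Q1u Q2w; apply: contrapT => /eqP h; apply: nQ; exists u, w.
  have Epq p q : P1 p -> P2 q -> E p q = E p f1 * E e1 q.
    move=> /projQ1[p0 Q1p0 pE] /projQ2[q0 Q2q0 qE].
    rewrite {1}pE {1}qE (polDl pol) !(polDr pol) !(polZl pol) !(polZr pol).
    by rewrite EQ0// Q1p0.2 Q2q0.2 Ee1f1 !mulr0 !add0r mulr1.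
  have rank2 v v' : v \in M -> v' \in M -> E v v' = E v f1 * E e1 v' - E v' f1 * E e1 v.
    move=> Mv Mv'.
    have [p [q [p' [q' [[P1p P2q P1p' P2q'] [vE vE' ->]]]]]] := Esplit v v' Mv Mv'.
    rewrite vE vE' !(polDl pol) !(polDr pol) (iso2 P2q.1 P2f1.1) (iso2 P2q'.1 P2f1.1).
    rewrite (iso1 P1e1.1 P1p.1) (iso1 P1e1.1 P1p'.1) !addr0 !add0r.
    by rewrite (Epq p q')// (Epq p' q)//.
  have [E01 _ _] := bE ord0 ord_max; have [_ _ E03] := bE ord0 ord_max.
  have [_ _ E12] := bE ord_max ord0; have [_ _ E13] := bE ord_max ord_max.
  have rb k l := rank2 _ _ (bM k) (bM l).
  move: bE02 E01 E03 E12 E13; rewrite !rb //= !mulr0n !mulr1n => E02 E01 E03 E12 E13.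
  pose x k := E (b k) f1; pose y k := E e1 (b k).
  have plucker k l m n : (x k * y m - x m * y k) * (x l * y n - x n * y l) =
    (x k * y l - x l * y k) * (x m * y n - x n * y m) +
    (x k * y n - x n * y k) * (x l * y m - x m * y l) by ring.
  have : (d%:R : R) = 0.
    rewrite -[LHS]mul1r -[X in X * _]E02 -[X in _ * X]E13 plucker.
    by rewrite /x /y E01 E03 mul0r mul0r addr0.
  by move/eqP; rewrite pnatr_eq0 -leqn0 leqNgt d_gt0.
exists e1, e2, f1, f2, g; split=> //.
- move=> u /projQ1[u0 Q1u0 ->]; rewrite (polDl pol) (polZl pol) Ee1f2 mulr0 addr0.
  exact: gP.
- move=> w /projQ2[w0 Q2w0 ->]; rewrite (polDr pol) (polZr pol) Ee2f1 mulr0 addr0.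
  exact: gP.
Qed.

Hypothesis index_ge : forall (T : finType) (r : T -> V),
  (forall v, v \in M -> exists t, v - r t \in L) -> (d <= #|T|)%N.

(** Let P express the basis of L in that of M. Comparing Gram determinants gives d = |det P| g,
    while the index hypothesis gives d <= |det P|; hence g = 1. *)
Lemma symplectic_basis : exists x : 'I_(2 + 2) -> V,
  [/\ forall i : 'I_2, P1 (x (lshift 2 i)) /\ P2 (x (rshift 2 i)),
      forall i j : 'I_2, E (x (lshift 2 i)) (x (rshift 2 j)) = (i == j)%:R,
      forall v, v \in M -> exists c : 'rV[int]_(2 + 2), v = \sum_i x i *~ c ord0 i &
      forall v, v \in M -> v *+ d \in L].
Proof.
have [e1 [e2 [f1 [f2 [g [[[V1e1 Me1] [V1e2 Me2] [V2f1 Mf1] [V2f2 Mf2]] g0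
  [E11 E12 E21 E22] g1P g2P]]]]]] := elementary_divisors.
have gR : (g%:R : R) != 0 by rewrite pnatr_eq0 -lt0n.
pose x (i : 'I_(2 + 2)) := match fintype.split i with
  | inl j => if j == ord0 then e1 else e2
  | inr j => if j == ord0 then f1 else f2 end.
have xl (j : 'I_2) : x (lshift 2 j) = if j == ord0 then e1 else e2.
  by rewrite /x -[lshift 2 j]/(unsplit (inl j)) unsplitK.
have xr (j : 'I_2) : x (rshift 2 j) = if j == ord0 then f1 else f2.
  by rewrite /x -[rshift 2 j]/(unsplit (inr j)) unsplitK.
have xP (i : 'I_2) : P1 (x (lshift 2 i)) /\ P2 (x (rshift 2 i)).
  by rewrite xl xr; case: ifP.
have xE (i j : 'I_2) :
  E (x (lshift 2 i)) (x (rshift 2 j)) = (if i == ord0 then 1 else g%:R) *+ (i == j).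
  rewrite xl xr.
  case: (altP (i =P ord0)) => i0; case: (altP (j =P ord0)) => j0.
  - by rewrite i0 j0 eqxx.
  - by rewrite E12 i0 eq_sym (negbTE j0).
  - by rewrite E21 j0 (negbTE i0).
  - have -> : i == j.
      apply/eqP/val_inj; move: (ltn_ord i) (ltn_ord j) i0 j0.
      by rewrite -!val_eqE /=; lia.
    by rewrite E22.
have V2Z (a : R) w : V2 w -> V2 (a%:C *: w) by exact: subspaceZ.
(* [isotropic_expansion] asks for a dual family, so f2 is divided by g; for [V2] the roles are
   exchanged, which forces the signs on e1, e2. *)
have exp1 u : V1 u -> u = (E u f1)%:C *: e1 + (E u f2 / g%:R)%:C *: e2.
  move=> V1u.
  rewrite {1}(@isotropic_expansion R L E pol V1 e1 e2 f1 ((g%:R^-1)%:C *: f2)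
    sub1 iso1 V1e1 V1e2 _ _ _ _ u V1u)//.
  - by rewrite (polZr pol) mulrC.
  - by rewrite (polZr pol) E12 mulr0.
  - by rewrite (polZr pol) E22 mulVf.
have exp2 w : V2 w -> w = (E e1 w)%:C *: f1 + (E e2 w / g%:R)%:C *: f2.
  move=> V2w.
  rewrite {1}(@isotropic_expansion R L E pol V2 f1 f2 (- e1) (- (g%:R^-1)%:C *: e2)
    sub2 iso2 V2f1 V2f2 _ _ _ _ w V2w)//.
  - rewrite (polNr pol) -(pol_anti pol) scaleNr (polNr pol) (polZr pol) -mulrN.
    by rewrite -(pol_anti pol) [_^-1 * _]mulrC.
  - by rewrite (polNr pol) -(pol_anti pol).
  - by rewrite scaleNr (polNr pol) -(pol_anti pol) (polZl pol) E21 mulr0.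
  - by rewrite (polNr pol) -(pol_anti pol) E12.
  - by rewrite scaleNr (polNr pol) -(pol_anti pol) (polZl pol) E22 mulVf.
have xM v : v \in M -> exists c : 'rV[int]_(2 + 2), v = \sum_i x i *~ c ord0 i.
  move=> /splitM[u [w [[V1u Mu] [V2w Mw] ->]]].
  have /intrP[a1 a1E] := Eint Mu Mf1; have /intrP[c1 c1E] := Eint Me1 Mw.
  have [a2 a2E] := g1P u (conj V1u Mu); have [c2 c2E] := g2P w (conj V2w Mw).
  exists (\row_i nth 0 [:: a1; a2; c1; c2] i).
  rewrite big_split_ord /= !big_ord_recl !big_ord0 !xl !xr !mxE /= !addr0.
  by rewrite {1}(exp1 u V1u) {1}(exp2 w V2w) a1E c1E a2E c2E !mulfK// -!mulrz_scaleC.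
have [_ [b [[_ bL] bE]]] := polL.
have bM i : b i \in M.
  apply: subLM; apply/bL; exists (fun j => (j == i)%:Z); rewrite (bigD1 i)//= eqxx.
  by rewrite big1 ?addr0// => j /negbTE ->.
have /choice[p pE] : forall i, exists c : 'rV[int]_(2 + 2), b i = \sum_j x j *~ c ord0 j.
  by move=> i; apply: xM.
pose P : 'M[int]_(2 + 2) := \matrix_(i, j) p i ord0 j.
pose gram (y : 'I_(2 + 2) -> V) : 'M[R]_(2 + 2) := \matrix_(i, j) E (y i) (y j).
pose PR : 'M[R]_(2 + 2) := map_mx intr P.
have gramP : gram b = PR *m gram x *m PR^T.
  have Esuml F w : E (\sum_(k < 2 + 2) F k) w = \sum_k E (F k) w.
    by apply: (big_morph (E^~ w)); [move=> *; exact: (polDl pol)|exact: (pol0l pol)].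
  have Esumr F w : E w (\sum_(k < 2 + 2) F k) = \sum_k E w (F k).
    by apply: (big_morph (E w)); [move=> *; exact: (polDr pol)|exact: (pol0r pol)].
  apply/matrixP => i j; rewrite -mulmxA mxE pE Esuml [RHS]mxE; apply: eq_bigr => k _.
  rewrite (polMzl pol) !mxE pE Esumr; congr (_ * _); apply: eq_bigr => l _.
  by rewrite (polMzr pol) !mxE mulrC.
have gram_anti y i j : gram y j i = - gram y i j by rewrite !mxE (pol_anti pol).
have xiso (i j : 'I_2) :
  E (x (lshift 2 i)) (x (lshift 2 j)) = 0 /\ E (x (rshift 2 i)) (x (rshift 2 j)) = 0.
  have [[V1i _] [V2i _]] := xP i; have [[V1j _] [V2j _]] := xP j.
  by split; [exact: iso1|exact: iso2].
have det_b := @det_gram R (gram b) d%:R _ (gram_anti b).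
have det_x := @det_gram R (gram x) g%:R _ (gram_anti x).
set J := block_mx _ _ _ _ in det_b det_x.
have {}det_b : \det (gram b) * \det J = d%:R ^+ 2.
  by apply: det_b => i j; rewrite !mxE; exact: bE.
have {}det_x : \det (gram x) * \det J = g%:R ^+ 2.
  by apply: det_x => i j; rewrite !mxE xE; case: (xiso i j).
have dP : (d = `|\det P| * g)%N.
  have detE : (\det P)%:~R ^+ 2 * g%:R ^+ 2 = d%:R ^+ 2 :> R.
    by rewrite -det_b -det_x gramP !det_mulmx det_tr det_map_mx; ring.
  have : (`|\det P| * g)%:R ^+ 2 = d%:R ^+ 2 :> R.
    rewrite natrM exprMn natr_absz intr_norm -normrX ger0_norm ?sqr_ge0//.
  by move=> /eqP; rewrite eqrXn2// eqr_nat => /eqP ->.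
have P0 : \det P != 0.
  by apply: contraTneq d_gt0 => P0; rewrite dP P0.
have [T [r [cardT rP]]] := card_cosets_le P0.
have inL (q : 'rV[int]_(2 + 2)) : \sum_j x j *~ (q *m P) ord0 j \in L.
  apply/bL; exists (fun i => q ord0 i).
  under eq_bigr do rewrite mxE mulrz_sumr.
  rewrite exchange_big /=; apply: eq_bigr => i _.
  rewrite pE mulrz_suml; apply: eq_bigr => j _.
  by rewrite mxE mulrC mulrzA.
have d_le : (d <= `|\det P|)%N.
  rewrite -cardT; apply: (index_ge (r := fun t => \sum_j x j *~ (r t) ord0 j)).
  move=> v /xM[c ->]; have [t [q ->]] := rP c; exists t.
  rewrite -sumrB; have := inL q; congr (_ \in L); apply: eq_bigr => j _.
  by rewrite [in RHS]mxE mulrzDr addrC addKr.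
have g1 : g = 1%N.
  move: d_le; rewrite {1}dP -[leqRHS]muln1 leq_pmul2l ?absz_gt0// => g1.
  by apply/eqP; rewrite eqn_leq g1.
exists x; split=> //.
  by move=> i j; rewrite xE g1; case: ifP => _; case: eqP.
move=> v /xM[c ->].
(* Since adj(P) P = det P = d up to sign, this element of L is d v up to sign. *)
have : \sum_j x j *~ (c *m \adj P *m P) ord0 j \in L by exact: inL.
have -> : \sum_j x j *~ (c *m \adj P *m P) ord0 j = (\sum_j x j *~ c ord0 j) *~ \det P.
  rewrite -mulmxA mul_adj_mx mul_mx_scalar mulrz_suml; apply: eq_bigr => j _.
  by rewrite mxE mulrC mulrzA.
rewrite g1 muln1 in dP.
by rewrite dP; case: (\det P) => n /=; rewrite ?NegzE ?mulrNz ?rpredN.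
Qed.

End SymplecticLattice.

(** * Half-periods and fixed points *)

Section HalfPeriods.
Variable R : realType.
Local Notation C := R[i].
Local Notation V := 'rV[R[i]]_2.
Variables (L M : zmodClosed V) (E : V -> V -> R) (V1 V2 : set V) (theta : V -> C).
Hypothesis pol : polarization L E.
Hypothesis theta_sec : is_section M (char0_bundle E V1 V2) theta.
Hypothesis theta_even : forall v, theta (- v) = theta v.
Let theta_holo := theta_sec.1.

Lemma theta_neg_translate l v : l \in M ->
  theta (- v + l) = char0_bundle E V1 V2 l (- v) * theta v.
Proof. by move=> Ml; rewrite theta_sec.2// theta_even. Qed.

Lemma half_neg_add (l : V) : - (2^-1 *: l) + l = 2^-1 *: l.
Proof.
apply/eqP; rewrite addrC subr_eq -scalerDl -[X in X == _]scale1r; apply/eqP.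
by congr (_ *: _); field.
Qed.

(** At -l/2 the two terms of the exponent, pi H(-l/2, l) and (pi/2) H(l, l), cancel. *)
Lemma char0_half l : char0_bundle E V1 V2 l (- (2^-1 *: l)) = chi0 E V1 V2 l.
Proof.
rewrite /char0_bundle /appell_humbert -scaleNr (hermZl pol).
have -> : (pi / 2)%:C = pi%:C * 2^-1 :> C by rewrite rmorphM fmorphV rmorph_nat.
by rewrite mulrA -mulrDl mulrN addNr mul0r cexp0 mulr1.
Qed.

Lemma theta_half_period l : l \in M ->
  theta (2^-1 *: l) = chi0 E V1 V2 l * theta (2^-1 *: l).
Proof.
by move=> Ml; rewrite -char0_half -theta_neg_translate// half_neg_add.
Qed.

Lemma holomorphic_hermitian l : holomorphic (fun v => Defs.hermitian E v l).
Proof.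
have -> : (fun v => Defs.hermitian E v l) =
    (fun v : V => v ord0 ord0) * cst (Defs.hermitian E (delta_mx ord0 ord0) l) +
    (fun v : V => v ord0 ord_max) * cst (Defs.hermitian E (delta_mx ord0 ord_max) l).
  apply/funext => v; rewrite {1}(row_sum_delta v) big_ord_recl big_ord1.
  rewrite (_ : lift ord0 ord0 = ord_max); last exact/val_inj.
  by rewrite (hermDl pol) !(hermZl pol).
exact: (holomorphicD (holomorphicM (holomorphic_coord _ _) (holomorphic_cst _))
  (holomorphicM (holomorphic_coord _ _) (holomorphic_cst _))).
Qed.

Lemma holomorphic_char0 l : holomorphic (char0_bundle E V1 V2 l).
Proof.
pose c := (pi / 2)%:C * Defs.hermitian E l l.
pose q v := pi%:C * Defs.hermitian E v l + c.
have q_holo : holomorphic q.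
  have -> : q = cst pi%:C * (fun v => Defs.hermitian E v l) + cst c by [].
  exact: (holomorphicD (holomorphicM (holomorphic_cst _) (holomorphic_hermitian l))
    (holomorphic_cst c)).
have -> : char0_bundle E V1 V2 l = cst (chi0 E V1 V2 l) * (fun v => cexp (q v)) by [].
exact: (holomorphicM (holomorphic_cst (chi0 E V1 V2 l)) (holomorphic_cexp q_holo)).
Qed.

(** Differentiate theta(-v + l) = e(v) theta(v) at l/2, the fixed point of v -> -v + l: the left
    side gives the opposite of the differential, the right side the differential itself, because
    theta vanishes there and e is 1. *)
Lemma diff_theta_half_period l : l \in M -> chi0 E V1 V2 l = 1 ->
  theta (2^-1 *: l) = 0 -> forall w, 'd theta (2^-1 *: l) w = 0.
Proof.
move=> Ml chil p0 w; set p := 2^-1 *: l in p0 *.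
pose e v := char0_bundle E V1 V2 l (- v).
have de : differentiable e p.
  exact: (holomorphic_opp (holomorphic_char0 l)).
have eq_theta : (fun v => theta (- v + l)) = e * theta.
  by apply/funext => v; exact: theta_neg_translate.
have dl : 'D_w (fun v => theta (- v + l)) p = 'D_(- w) theta p.
  apply: (congr1 (fun g : C -> C => lim (g @ (0 : C)^'))); apply/funext => h.
  by rewrite /= opprD -addrA half_neg_add scalerN.
have dp := theta_holo p.
have E1 : 'D_(- w) theta p = - 'd theta p w.
  exact: (etrans (deriveE (- w) dp) (linearN _ w)).
have E2 := deriveE w dp.
have E3 : 'D_w (e * theta) p = e p *: 'D_w theta p + theta p *: 'D_w e p.
  exact: (deriveM (diff_derivable de) (diff_derivable dp)).
have E4 : 'D_w (e * theta) p = 'd theta p w.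
  by rewrite E3 p0 scale0r addr0 E2 /e char0_half chil scale1r.
have : - 'd theta p w = 'd theta p w by rewrite -E1 -dl eq_theta E4.
by move/esym/eqP; rewrite -addr_eq0 -mulr2n mulrn_eq0 => /eqP.
Qed.

End HalfPeriods.

Local Open Scope card_scope.

(** * Passage between V and its quotients *)

Section Quotients.
Variable R : realType.
Local Notation V := 'rV[R[i]]_2.

Lemma eq_piP (L : zmodClosed V) (u v : V) :
  reflect (\pi_{ideal_quot L} u = \pi_{ideal_quot L} v) (u - v \in L).
Proof. by rewrite Quotient.idealrBE; apply: eqP. Qed.

Lemma repr_pi_sub (L : zmodClosed V) (v : V) : repr (\pi_{ideal_quot L} v) - v \in L.
Proof. by apply/eq_piP; rewrite reprK. Qed.

Variables (L : zmodClosed V) (X : zmodClosed {ideal_quot L}).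

Lemma sub_overlattice v : v \in L -> v \in overlattice X.
Proof.
move=> Lv; rewrite -[_ \in _]/(\pi_{ideal_quot L} v \in X).
have -> : \pi_{ideal_quot L} v = 0; last exact: rpred0.
by rewrite -(raddf0 \pi_{ideal_quot L}); apply/eq_piP; rewrite subr0.
Qed.

(** X is the overlattice modulo L, so the classes of representatives that cover the overlattice
    cover the d elements of X. *)
Lemma overlattice_index d (T : finType) (r : T -> V) : [set` X] #= `I_d ->
  (forall v, v \in overlattice X -> exists t, v - r t \in L) -> (d <= #|T|)%N.
Proof.
move=> cardX cover.
have [t0 _] := cover 0 (rpred0 _).
pose f k := \pi_{ideal_quot L} (r (nth t0 (enum T) k)).
have sub : [set` X] `<=` f @` `I_#|T|.
  move=> x /= Xx; have [|t vt] := cover (repr x).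
    by rewrite -[_ \in _]/(\pi_{ideal_quot L} (repr x) \in X) reprK.
  exists (enum_rank t); first exact: ltn_ord.
  by rewrite /f nth_enum_rank -[RHS]reprK; apply/esym/eq_piP.
rewrite -card_le_II -(card_le_eql cardX).
exact: card_le_trans (subset_card_le sub) (card_image_le _ _).
Qed.

End Quotients.

Lemma int_parity (k : int) :
  k = ((k %% 2)%Z == 1 : nat)%:Z + ((k %/ 2)%Z + (k %/ 2)%Z).
Proof.
rewrite {1}(divz_eq k 2); have := ltz_mod k (isT : 2 != 0 :> int).
by have := modz_ge0 k (isT : 2 != 0 :> int); case: eqP => /=; lia.
Qed.

Lemma parity_inj (b c : bool) (k : int) :
  (b : nat)%:Z = (c : nat)%:Z + (k + k) -> b = c.
Proof. by case: b c => [] []; lia. Qed.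

Theorem theorem0p3 (R : realType) (d : nat) (L : zmodClosed 'rV[R[i]]_2)
    (E : 'rV[R[i]]_2 -> 'rV[R[i]]_2 -> R)
    (X : zmodClosed {ideal_quot L}) (V1 V2 : set 'rV[R[i]]_2)
    (theta : 'rV[R[i]]_2 -> R[i]) :
  odd d ->
  polarization_type_1 d L E ->
  [set` X] #= `I_d ->
  real_subspace V1 -> real_subspace V2 -> direct_sum V1 V2 ->
  isotropic E V1 -> isotropic E V2 ->
  lattice_split L V1 V2 ->
  lattice_split (overlattice X) V1 V2 ->
  [set` X] `<=` K L (char0_bundle E V1 V2) ->
  is_section (overlattice X) (char0_bundle E V1 V2) theta ->
  (exists v, theta v != 0) ->
  smooth_curve (overlattice X) theta ->
  has_genus 2 (overlattice X) theta ->
  let C : set {ideal_quot L} :=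
    isogeny X @^-1` zero_divisor (overlattice X) theta in
  forall x : {ideal_quot L}, x \in X ->
    [set a | C a /\ neg_translate x a = a] #= `I_6.
Proof.
move=> d_odd polL cardX sub1 sub2 split12 iso1 iso2 _ splitM _ sec theta_neq0
  [smooth _] _ C x Xx.
have pol := polL.1; pose M : zmodClosed 'rV[R[i]]_2 := overlattice X.
have d_gt0 : (0 < d)%N by case: (d) d_odd.
have Eint l m : l \in M -> m \in M -> E l m \is a Num.int.
  exact: (section_integral pol sec theta_neq0).
have subLM v : v \in L -> v \in M by exact: sub_overlattice.
have index_ge (T : finType) (r : T -> 'rV[R[i]]_2) :
    (forall v, v \in M -> exists t, v - r t \in L) -> (d <= #|T|)%N.
  exact: overlattice_index.
have [b [bP bE bM dM]] := symplectic_basis d_gt0 polL sub1 sub2 iso1 iso2 splitM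
  Eint subLM index_ge.
pose e1 := b (lshift 2 ord0); pose e2 := b (lshift 2 ord_max).
pose f1 := b (rshift 2 ord0); pose f2 := b (rshift 2 ord_max).
have [[V1e1 Me1] [V2f1 Mf1]] : (V1 e1 /\ e1 \in M) /\ (V2 f1 /\ f1 \in M) := bP ord0.
have [[V1e2 Me2] [V2f2 Mf2]] : (V1 e2 /\ e2 \in M) /\ (V2 f2 /\ f2 \in M) := bP ord_max.
have E11 : E e1 f1 = 1 := bE ord0 ord0.
have E12 : E e1 f2 = 0 := bE ord0 ord_max.
have E21 : E e2 f1 = 0 := bE ord_max ord0.
have E22 : E e2 f2 = 1 := bE ord_max ord_max.
have even := section_even pol sub1 sub2 split12 iso1 V1e1 V1e2 V2f1 V2f2 E11 E12 E21 E22
  Me1 Me2 Mf1 Mf2 sec.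
pose u1 (a c : int) := e1 *~ a + e2 *~ c.
pose u2 (a c : int) := f1 *~ a + f2 *~ c.
have V1u a c : V1 (u1 a c).
  by rewrite /u1 !mulrz_scaleC; apply: sub1.2 => //; exact: subspaceZ.
have V2u a c : V2 (u2 a c).
  by rewrite /u2 !mulrz_scaleC; apply: sub2.2 => //; exact: subspaceZ.
have Eu a1 a2 c1 c2 : E (u1 a1 a2) (u2 c1 c2) = (a1 * c1 + a2 * c2)%:~R.
  rewrite /u1 /u2 !(polDl pol) !(polDr pol) !(polMzl pol, polMzr pol) E11 E12 E21 E22.
  by rewrite !(mulr0, mulr1, addr0, add0r) intrD !intrM.
pose lam (m : int * int * int * int) := u1 m.1.1.1 m.1.1.2 + u2 m.1.2 m.2.
have Mlam m : lam m \in M.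
  by rewrite /lam /u1 /u2 !rpredD// rpredMz.
have lamP v : v \in M -> exists m, v = lam m.
  have lift_max : lift ord0 ord0 = ord_max :> 'I_2 by apply/val_inj.
  move=> /bM[c ->]; exists (c ord0 (lshift 2 ord0), c ord0 (lshift 2 ord_max),
    c ord0 (rshift 2 ord0), c ord0 (rshift 2 ord_max)).
  by rewrite big_split_ord /= !big_ord_recl !big_ord0 !lift_max !addr0.
have lamD m n : lam m + lam n =
  lam (m.1.1.1 + n.1.1.1, m.1.1.2 + n.1.1.2, m.1.2 + n.1.2, m.2 + n.2).
  by rewrite /lam /u1 /u2 /= !mulrzDr addrACA; congr (_ + _); rewrite addrACA.
have Elam1 m c1 c2 : E (lam m) (u2 c1 c2) = (m.1.1.1 * c1 + m.1.1.2 * c2)%:~R.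
  by rewrite /lam (polDl pol) Eu (iso2 _ _ (V2u _ _) (V2u _ _)) addr0.
have Elam2 m c1 c2 : E (u1 c1 c2) (lam m) = (c1 * m.1.2 + c2 * m.2)%:~R.
  by rewrite /lam (polDr pol) Eu (iso1 _ _ (V1u _ _) (V1u _ _)) add0r.
have lam_inj : injective lam.
  move=> m n mn.
  have h1 c1 c2 : m.1.1.1 * c1 + m.1.1.2 * c2 = n.1.1.1 * c1 + n.1.1.2 * c2.
    by apply/eqP; rewrite -(eqr_int R) -!Elam1 mn.
  have h2 c1 c2 : c1 * m.1.2 + c2 * m.2 = c1 * n.1.2 + c2 * n.2.
    by apply/eqP; rewrite -(eqr_int R) -!Elam2 mn.
  have := h1 1 0; have := h1 0 1; have := h2 1 0; have := h2 0 1.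
  rewrite !(mulr0, mul0r, mulr1, mul1r, addr0, add0r) {h1 h2 mn}.
  by move: m n => [[[? ?] ?] ?] [[[? ?] ?] ?] /= -> -> -> ->.
have theta_M u v : u - v \in M -> theta u = 0 <-> theta v = 0.
  move=> Muv; rewrite -(subrK v u) addrC (sec.2 _ _ Muv).
  split=> [/eqP|->]; last exact: mulr0.
  rewrite mulf_eq0 => /orP[|/eqP//].
  by rewrite (negbTE (mulf_neq0 (cexp_neq0 _) (cexp_neq0 _))).
(* Half-periods are the lam (vec m) / 2; the 6 odd ones are those with odd_char m. *)
pose vec (m : bool * bool * bool * bool) : int * int * int * int :=
  ((m.1.1.1 : nat) : int, (m.1.1.2 : nat) : int, (m.1.2 : nat) : int, (m.2 : nat) : int).
pose odd_char (m : bool * bool * bool * bool) := (m.1.1.1 && m.1.2) (+) (m.1.1.2 && m.2).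
have chiE m : chi0 E V1 V2 (lam (vec m)) = if odd_char m then -1 else 1.
  rewrite /lam (chi0D E sub1 sub2 split12 (V1u _ _) (V2u _ _)) Eu.
  have cexp_i (y : R) : cexp (y%:C * 'i) = cos y +i* sin y.
    by rewrite /cexp /= !(mulr0, mul0r, mulr1, subr0, add0r, addr0) oppr0 expR0 mul1r.
  rewrite cexp_i.
  have e0 : cos (pi * 0) +i* sin (pi * 0) = 1 :> R[i] by rewrite mulr0 cos0 sin0.
  have e1' : cos (pi * 1) +i* sin (pi * 1) = -1 :> R[i].
    rewrite mulr1 cospi sinpi; apply/eqP; rewrite eq_complex /=.
    by rewrite oppr0 !eqxx.
  have e2' : cos (pi * 2) +i* sin (pi * 2) = 1 :> R[i].
    by rewrite mulr_natr cos2pi sin2pi.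
  by case: m => [[[[] []] []] []]; rewrite /= ?e0 ?e1' ?e2'.
(* At an even half-period a zero would have zero differential, against smoothness; at an odd one
   theta equals its own opposite. *)
have half_zero m : theta (2^-1 *: lam (vec m)) = 0 <-> odd_char m.
  have half := theta_half_period pol sec even (Mlam (vec m)).
  split=> [p0|om].
    apply: contrapT => /negP/negbTE nm; have chi1 := chiE m; rewrite nm in chi1.
    have [w] := smooth _ p0.
    by rewrite (diff_theta_half_period pol sec even (Mlam _) chi1 p0) eqxx.
  move: half; rewrite chiE om mulN1r => /eqP.
  by rewrite -addr_eq0 -mulr2n mulrn_eq0 => /eqP.
pose xi := repr x.
have Mxi : xi \in M.
  by rewrite -[_ \in _]/(\pi_{ideal_quot L} (repr x) \in X) reprK.
(* The lift of the half-period l/2 that is fixed: as d = 2 (d./2) + 1, twice this point plus [xi] is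
   d (l + xi), which lies in L because dM does. *)
pose pt m := 2^-1 *: lam (vec m) + (lam (vec m) + xi) *+ d./2.
have half2 (l : 'rV[R[i]]_2) : 2^-1 *: l + 2^-1 *: l = l.
  by rewrite -scalerDl -[RHS]scale1r; congr (_ *: _); field.
have pt2 m : pt m + pt m + xi \in L.
  have -> : pt m + pt m + xi = (lam (vec m) + xi) *+ d.
    rewrite /pt -[d in RHS]odd_double_half d_odd mulrnDr -addnn mulrnDr.
    by rewrite mulr1n addrACA half2 addrAC.
  by apply: dM; apply: rpredD; [exact: Mlam|exact: Mxi].
have pt_half m : pt m - 2^-1 *: lam (vec m) \in M.
  rewrite /pt addrC addKr; apply: rpredMn; apply: rpredD; [exact: Mlam|exact: Mxi].
(* [C] evaluates theta after choosing a representative modulo L and then one modulo M; both choices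
   differ from [v] by elements of M. *)
have CP v : C (\pi_{ideal_quot L} v) <-> theta v = 0.
  apply: theta_M; rewrite -(subrK (repr (\pi_{ideal_quot L} v)) (repr _)) -addrA.
  by apply: rpredD; [exact: repr_pi_sub|apply: subLM; exact: repr_pi_sub].
have fixP v : neg_translate x (\pi_{ideal_quot L} v) = \pi_{ideal_quot L} v <->
  v + v + xi \in L.
  rewrite /neg_translate -[x]reprK -/xi -raddfD -raddfN.
  have -> : (v + v + xi \in L) = (- (v + xi) - v \in L).
    by rewrite -opprD rpredN addrAC.
  by split=> [/eq_piP|h]; [|apply/eq_piP].
pose s := [:: (true, false, true, false); (true, false, true, true);
  (true, true, true, false); (false, true, false, true);
  (false, true, true, true); (true, true, false, true)].
have sP m : (m \in s) = odd_char m.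
  by case: m => [[[[] []] []] []].
pose phi k := \pi_{ideal_quot L} (pt (nth (true, false, true, false) s k)).
have -> : [set a | C a /\ neg_translate x a = a] = phi @` `I_6.
  apply/seteqP; split=> [a [Ca fa]|a [k k6 <-]] /=; last first.
    split; last by apply/fixP.
    apply/CP; apply/(theta_M _ _ (pt_half _))/half_zero.
    by rewrite -sP mem_nth.
  have aE : a = \pi_{ideal_quot L} (repr a) by rewrite reprK.
  move: Ca fa; rewrite aE => /CP theta0 /fixP vL; set v := repr a in theta0 vL *.
  have /lamP[n nE] : v + v \in M.
    by rewrite -[v + v](addrK xi) rpredB// subLM.
  (* A fixed point has 2v in M, so v is a half-period modulo M, named by the parities of the
     coordinates of 2v. *)
  pose m := ((n.1.1.1 %% 2)%Z == 1, (n.1.1.2 %% 2)%Z == 1,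
    (n.1.2 %% 2)%Z == 1, (n.2 %% 2)%Z == 1).
  pose h := ((n.1.1.1 %/ 2)%Z, (n.1.1.2 %/ 2)%Z, (n.1.2 %/ 2)%Z, (n.2 %/ 2)%Z).
  have nmh : lam n = lam (vec m) + (lam h + lam h).
    rewrite !lamD /vec /m /h /=; congr lam; case: (n) => [[[a1 a2] a3] a4] /=.
    by congr (_, _, _, _); exact: int_parity.
  have v_half : v - 2^-1 *: lam (vec m) \in M.
    by rewrite -[v]half2 -scalerDr nE nmh scalerDr addrAC subrr add0r scalerDr half2.
  have ms : m \in s by rewrite sP; apply/half_zero/(theta_M _ _ v_half).
  exists (index m s); first by rewrite /= -index_mem in ms *.
  rewrite /phi nth_index//; apply/esym/eq_piP.
  set mu := v - pt m.
  have Mmu : mu \in M.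
    by rewrite /mu -(subrKA (2^-1 *: lam (vec m))) rpredD// -opprB rpredN.
  have Lmu2 : mu + mu \in L.
    have -> : mu + mu = (v + v + xi) - (pt m + pt m + xi).
      by rewrite [in RHS]opprD [RHS]addrACA subrr addr0 /mu addrACA -opprD.
    exact: rpredB.
  (* Uniqueness of the lift: mu is in M and 2 mu in L, and an odd d recovers mu from d mu and 2 mu,
     both in L. *)
  have -> : mu = mu *+ d - (mu + mu) *+ d./2.
    by rewrite -[d in mu *+ d]odd_double_half d_odd mulrnDr mulr1n -mul2n mulrnA mulr2n addrK.
  by apply: rpredB; [exact: dM|exact: rpredMn].
(* Points equal modulo L give half-periods equal modulo M, whose doubles have coordinates of equal
   parity. *)
apply: inj_card_eq => i j; rewrite !inE /= => i6 j6 /eq_piP/subLM.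
set m := nth _ s i; set n := nth _ s j => ptij.
have /lamP[r rE] : 2^-1 *: lam (vec m) - 2^-1 *: lam (vec n) \in M.
  rewrite -(subrKA (pt m)) -(subrKA (pt n) (pt m)) rpredD//.
    by rewrite -opprB rpredN.
  by rewrite rpredD.
have : lam (vec m) = lam (vec n) + (lam r + lam r).
  by rewrite -rE [(_ - _) + (_ - _)]addrACA half2 -opprD half2 [RHS]addrCA subrr addr0.
rewrite !lamD => /lam_inj[].
move=> /parity_inj h1 /parity_inj h2 /parity_inj h3 /parity_inj h4.
have mn : m = n.
  by move: m n h1 h2 h3 h4 {ptij rE} => [[[? ?] ?] ?] [[[? ?] ?] ?] /= -> -> -> ->.
have isz : (i < size s)%N by [].
have jsz : (j < size s)%N by [].
by apply/eqP; rewrite -(nth_uniq (true, false, true, false) isz jsz (isT : uniq s)) -/m mn.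
Qed.
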